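(* Let $S$ be a dense subgroup of $(\mathbb{R},+)$, let $b\in S_{>0}\cup\{\infty\}$, let $\mathcal{U}$ be an $\mathcal{S}_b$-Urysohn space and $G=\mathrm{Isom}(\mathcal{U})$. Then there are exactly four group topologies on $G$ coarser than $\tau_{st}$, namely $$\tau_{st}\supsetneq\tau_{0^{+},0}\supsetneq\tau_{m}\supsetneq\{\emptyset,G\},$$ where $\tau_{0^{+},0}$ is the group topology generated at the identity by the collection $\{\{g\in G: d(gu,v)=d(u,v)\}: u,v\in\mathcal{U},\ d(u,v)>0\}$.
   Context: $\mathcal{S}_b$ is the distance monoid with underlying set $\{r\in S: 0\leq r\leq b\}$, the usual order, $0$, and the operation $x+_b y=\min\{x+y,b\}$ (ordinary addition if $b=\infty$). An $\mathcal{S}_b$-metric space is a set with a distance function into this set satisfying the metric axioms with $+_b$ in the triangle inequality. An $\mathcal{S}_b$-Urysohn space is an $\mathcal{S}_b$-metric space into which every finite $\mathcal{S}_b$-metric space embeds isometrically and in which every isometry between finite subspaces extends to a global isometry. $\tau_{st}$ is the group topology on $G$ with base of identity neighbourhoods the pointwise stabilizers $G_A$ of finite $A\subseteq\mathcal{U}$; $\tau_m$ is the pointwise convergence topology, generated at the identity by $N_u(\epsilon)=\{g\in G: d(gu,u)\leq\epsilon\}$ for $u\in\mathcal{U}$, $\epsilon\in S$, $0<\epsilon\leq b$.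
   Formalization: For finite b, pairs with d(u,v)=b would make the topology generated by the given sets equal τ_st; here ''generated at the identity'' means the finest group topology whose identity neighbourhoods lie in the filter generated by the collection, the usual notion when b=∞. *)

(* Defs.v *)
From HB Require Import structures.
From mathcomp Require Import all_boot all_order all_algebra.
From mathcomp Require Import all_classical all_reals all_analysis.
Set Implicit Arguments.
Unset Strict Implicit.
Unset Printing Implicit Defensive.
Import Order.TTheory GRing.Theory Num.Theory.
Import numFieldNormedType.Exports.

Local Open Scope classical_set_scope.
Local Open Scope ring_scope.

(* The bound b ranges over \bar R so that b = +oo is the unbounded case.
   As elements of the monoid are elements of S, hence real, the value +oo itself
   is never a distance, and fine below only strips the injection %:E. *)
Definition Sb_carrier (R : realType) (S : set R) (b : \bar R) : set R :=
  [set r | [/\ S r, 0 <= r & (r%:E <= b)%E]].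

Definition Sb_add (R : realType) (b : \bar R) (x y : R) : R :=
  fine (Order.min (x + y)%:E b).

Definition Sb_metric (R : realType) (S : set R) (b : \bar R)
    (T : Type) (d : T -> T -> R) : Prop :=
  [/\ forall x y, Sb_carrier S b (d x y),
      forall x y, d x y = 0 <-> x = y,
      forall x y, d x y = d y x
    & forall x y z, d x z <= Sb_add b (d x y) (d y z)].

Record Isom (R : realType) (U : Type) (d : U -> U -> R) := MkIsom {
  isom_fun :> U -> U;
  isom_dist : forall x y, d (isom_fun x) (isom_fun y) = d x y;
  isom_bij : bijective isom_fun
}.

Definition Sb_urysohn (R : realType) (S : set R) (b : \bar R)
    (U : Type) (d : U -> U -> R) : Prop :=
  [/\ Sb_metric S b d,
      forall (F : finType) (dF : F -> F -> R), Sb_metric S b dF ->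
        exists f : F -> U, forall x y, d (f x) (f y) = dF x y
    & forall (A : set U) (f : U -> U), finite_set A ->
        {in A &, forall x y, d (f x) (f y) = d x y} ->
        exists g : Isom d, {in A, forall x, g x = f x}].

Section IsometryGroup.
Variables (R : realType) (U : Type) (d : U -> U -> R).
Local Notation G := (Isom d).

Lemma isom_eq (g h : G) : (forall x, g x = h x) -> g = h.
Proof.
case: g h => [g gd gb] [h hd hb] /= /funext gh; subst h.
by rewrite (Prop_irrelevance gd hd) (Prop_irrelevance gb hb).
Qed.

Definition isom_one : G := @MkIsom R U d id (fun _ _ => erefl) (inv_bij (fun=> erefl)).

Lemma isom_mulP (g h : G) x y : d ((g \o h) x) ((g \o h) y) = d x y.
Proof. by rewrite /= !isom_dist. Qed.

Definition isom_mul (g h : G) : G :=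
  MkIsom (isom_mulP g h) (bij_comp (isom_bij g) (isom_bij h)).

Lemma isom_inv_ex (g : G) : exists h : G, cancel g h /\ cancel h g.
Proof.
have [f gK fK] := isom_bij g.
have fd x y : d (f x) (f y) = d x y by rewrite -(isom_dist g) !fK.
by exists (MkIsom fd (Bijective fK gK)).
Qed.

Definition isom_invg (g : G) : G := projT1 (cid (isom_inv_ex g)).

Lemma isom_invK (g : G) : cancel g (isom_invg g).
Proof. by rewrite /isom_invg; case: cid => h []. Qed.

Lemma isom_invKV (g : G) : cancel (isom_invg g) g.
Proof. by rewrite /isom_invg; case: cid => h []. Qed.

Fact isom_mulA : associative isom_mul.
Proof. by move=> f g h; exact: isom_eq. Qed.
Fact isom_mul1 : left_id isom_one isom_mul.
Proof. by move=> f; exact: isom_eq. Qed.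
Fact isom_mulr1 : right_id isom_one isom_mul.
Proof. by move=> f; exact: isom_eq. Qed.
Fact isom_mulV : left_inverse isom_one isom_invg isom_mul.
Proof. by move=> f; apply: isom_eq => x; exact: isom_invK. Qed.
Fact isom_mulrV : right_inverse isom_one isom_invg isom_mul.
Proof. by move=> f; apply: isom_eq => x; exact: isom_invKV. Qed.

HB.instance Definition _ := gen_eqMixin G.
HB.instance Definition _ := gen_choiceMixin G.
HB.instance Definition _ := isGroup.Build G
  isom_mulA isom_mul1 isom_mulr1 isom_mulV isom_mulrV.

End IsometryGroup.

(* Topologies are handled as their sets of open sets; no separation axiom is
   assumed, so the indiscrete topology is a group topology. *)
Definition is_topology (T : Type) (tau : set_system T) : Prop :=
  [/\ tau setT, setI_closed tau
    & forall C : set_system T, C `<=` tau -> tau (\bigcup_(A in C) A)].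

Definition group_topology (G : groupType) (tau : set_system G) : Prop :=
  [/\ is_topology tau,
      forall g h : G,
        fmap (fun p : G * G => (p.1 * p.2)%g)
          (filter_prod (nbhs_of_open tau g) (nbhs_of_open tau h))
        `=>` nbhs_of_open tau (g * h)%g
    & forall g : G,
        fmap (fun x : G => x^-1%g) (nbhs_of_open tau g)
        `=>` nbhs_of_open tau g^-1%g].

Definition generates_at_identity (G : groupType) (B tau : set_system G) : Prop :=
  group_topology tau /\ nbhs_of_open tau 1%g = smallest (@Filter G) B.

(* The finest group topology all of whose neighbourhoods of 1 contain a finite
   intersection of members of B. If the filter generated by B is the filter of
   neighbourhoods of 1 of some group topology, this is that topology
   (generated_group_topologyE). For an arbitrary B that filter need not be such,
   and the finest group topology below it is taken; see tau_0p0. *)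
Definition generated_group_topology (G : groupType) (B : set_system G) :
    set_system G :=
  smallest (@group_topology G)
    (\bigcup_(tau in [set tau | group_topology tau /\
        nbhs_of_open tau 1%g `<=` smallest (@Filter G) B]) tau).

Lemma generated_group_topologyE (G : groupType) (B tau : set_system G) :
  generates_at_identity B tau -> generated_group_topology B = tau.
Proof.
move=> [tauG tauB]; rewrite /generated_group_topology.
suff -> : \bigcup_(t in [set t | group_topology t /\
    nbhs_of_open t 1%g `<=` smallest (@Filter G) B]) t = tau.
  exact: smallest_id.
apply/seteqP; split=> [A [t [[tT tM tV] tB] tA]|A tauA]; last first.
  by exists tau => //; split=> //; rewrite tauB.
have [[topT topI topU] mulc invc] := tauG.
have nbhsO g : A g -> nbhs_of_open tau g A.
  move=> Ag.
  have tAg : nbhs_of_open t (g * 1)%g A by rewrite mulg1; exists A; split.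
  have [[P Q] /= [[P1 [_ P1g P1P]] Qn] PQA] := tM g 1%g A tAg.
  have: nbhs_of_open tau (g^-1 * g)%g Q.
    by rewrite mulVg tauB; exact: tB.
  move=> /(mulc g^-1%g g) [[P' Q'] /= [[P1' [_ P1'g P1'P]] [V [tauV Vg VQ']]] PQ'].
  exists V; split => // x Vx.
  have: Q (g^-1 * x)%g by apply: (PQ' (_, _)); split=> /=; [exact: P1'P|exact: VQ'].
  move=> Qx; have := PQA (g, g^-1 * x)%g; rewrite /= mulVKg; apply.
  by split=> //; exact: P1P.
have -> : A = \bigcup_(C in [set C | tau C /\ C `<=` A]) C.
  apply/seteqP; split=> [x /nbhsO [C [tC Cx CA]]|x [C [_ CA] Cx]]; last exact: CA.
  by exists C.
by apply: topU => C [].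
Qed.

Section IsometryGroupTopologies.
Variables (R : realType) (S : set R) (b : \bar R).
Variables (U : Type) (d : U -> U -> R).

Definition pointwise_stabilizer (A : set U) : set (Isom d) :=
  [set g | forall x, A x -> g x = x].

Definition tau_st : set_system (Isom d) :=
  generated_group_topology
    [set pointwise_stabilizer A | A in [set A | finite_set A]].

Definition displacement_ball (u : U) (e : R) : set (Isom d) :=
  [set g | d (g u) u <= e].

Definition tau_m : set_system (Isom d) :=
  generated_group_topology
    [set N | exists u e, [/\ S e, 0 < e, (e%:E <= b)%E
                           & N = displacement_ball u e]].

Definition distance_preserver (u v : U) : set (Isom d) :=
  [set g | d (g u) v = d u v].

(* If b is finite, the pairs at distance exactly b belong to the family, and then
   the generated filter is not the neighbourhood filter of a group topology: a
   group topology coarser than tau_st in which distance_preserver u v is a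
   neighbourhood of 1 for all pairs u, v of distinct points, including those at
   distance b, is tau_st itself. *)
Definition tau_0p0 : set_system (Isom d) :=
  generated_group_topology
    [set W | exists u v, 0 < d u v /\ W = distance_preserver u v].

End IsometryGroupTopologies.

Definition indiscrete (T : Type) : set_system T := [set set0; setT].

Arguments pointwise_stabilizer {R U} d A.
Arguments displacement_ball {R U} d u e.
Arguments distance_preserver {R U} d u v.
Arguments tau_st {R U} d.
Arguments tau_m {R} S b {U} d.
Arguments tau_0p0 {R U} d.
Arguments indiscrete T : clear implicits.

(* Main.v *)
Require Import Defs.
From mathcomp Require Import all_boot all_order all_algebra.
From mathcomp Require Import all_classical all_reals all_analysis.
From mathcomp Require Import lra.
Set Implicit Arguments.
Unset Strict Implicit.
Unset Printing Implicit Defensive.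
Import Order.TTheory GRing.Theory Num.Theory.
Import numFieldNormedType.Exports.
Local Open Scope classical_set_scope.
Local Open Scope ring_scope.

(* Group topologies correspond to their filters F of neighbourhoods of 1, and F is
   coarser than the stabilizer filter iff every N in F contains the pointwise
   stabilizer G_x of a finite tuple x. If V in F is small enough with respect to N
   and x to V, then N contains every g whose distance matrix d(g x_i, x_j) equals
   d(k h1 x_i, h2 x_j) for some h1, h2 in V and k in G_x, and by amalgamation this
   matrix can be prescribed up to the triangle inequalities involving x. Four steps
   follow.
   (1) If some ball {g | d(g u, u) <= e} is not in F, then repeated free
   amalgamation makes h x arbitrarily far from x with h in V, so that N contains
   every g; hence F is trivial or contains the filter of tau_m.
   (2) If F contains the filter of tau_m but not the stabilizers, h x can be made
   disjoint from x, and F is coarser than the filter of tau_{0+,0}.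
   (3) If {h | d(h u, v) <= d(u, v)} is in F for some u <> v with 2 d(u, v) <= b,
   then the same holds at arbitrarily small distances, and this gives all
   {h | d(h u, v) = d(u, v)} with 0 < d(u, v) < b.
   (4) Otherwise some h in V moves x off every segment between two of its points at
   distance < b; then the amalgams of two copies of h x over x have no forced
   distance, so some h' in V puts h' x in generic position over x, and N contains
   every g moving the points of x by little: F is coarser than the filter of tau_m. *)

(** * Group topologies and filters *)

Section GroupFilters.
Variable G : groupType.
Implicit Types (F tau : set_system G) (A N V : set G) (g h k x y : G).

Definition group_filter F : Prop :=
  [/\ Filter F, forall N, F N -> N 1%g,
      forall N, F N -> exists2 V, F V & forall x y, V x -> V y -> N (x * y)%g,
      forall N, F N -> F [set x | N x^-1%g]
    & forall k N, F N -> F [set x | N (k^-1 * x * k)%g]].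

Definition translation_topology F : set_system G :=
  [set A | forall g, A g -> F [set x | A (g * x)%g]].

Lemma nbhs_translation F g A : group_filter F ->
  nbhs_of_open (translation_topology F) g A <-> F [set x | A (g * x)%g].
Proof.
move=> [FF F1 FM _ _]; split=> [[B [oB Bg BA]]|FA].
  by apply: filterS (oB g Bg) => x; exact: BA.
exists [set h | F [set x | A (h * x)%g]]; split=> //.
- move=> h /= /FM[V FV VV]; apply: filterS (FV) => y Vy /=.
  by apply: filterS (FV) => x Vx; rewrite /= -mulgA; exact: VV.
- by move=> h /= /F1; rewrite /= mulg1.
Qed.

Lemma nbhs_translation1 F : group_filter F ->
  nbhs_of_open (translation_topology F) 1%g = F.
Proof.
move=> gF; have mul1A A : [set x | A (1 * x)%g] = A.
  by apply/seteqP; split=> x /=; rewrite mul1g.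
by apply/seteqP; split=> A; rewrite nbhs_translation// mul1A.
Qed.

Lemma group_topology_translation F : group_filter F ->
  group_topology (translation_topology F).
Proof.
move=> gF; have [FF F1 FM FV FJ] := gF; split.
- split=> [g _|A B oA oB g [Ag Bg]|C CF g [A CA Ag]].
  + exact: filterT.
  + by apply: filterI; [exact: oA|exact: oB].
  + by apply: filterS (CF A CA g Ag) => x Ax; exists A.
- move=> g h A; rewrite nbhs_translation// => /FM[V FV' VV].
  exists ([set p | V (h^-1 * (g^-1 * p) * h)%g], [set q | V (h^-1 * q)%g]).
    split=> /=; rewrite nbhs_translation//=.
      by under eq_set do rewrite mulKg; exact: FJ.
    by under eq_set do rewrite mulKg.
  move=> [p q] /= [Vp Vq]; have := VV _ _ Vp Vq.
  by rewrite /= !mulgA !mulgK mulgV mul1g.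
- move=> g A /(nbhs_translation _ _ gF)/(FJ g^-1%g)/FV FA.
  apply/(nbhs_translation _ _ gF); apply: filterS FA => x /=.
  by rewrite invgK invgM !mulgA mulVg mul1g.
Qed.

Lemma group_filter_nbhs tau : group_topology tau ->
  group_filter (nbhs_of_open tau 1%g).
Proof.
move=> [[tT tI tU] tM tV].
have nF g : Filter (nbhs_of_open tau g).
  split=> [|A B [A' [tA' A'g A'A]] [B' [tB' B'g B'B]]|A B AB [A' [tA' A'g A'A]]].
  - by exists setT; split.
  - exists (A' `&` B'); split=> //; first exact: tI.
    by move=> x [/A'A ? /B'B].
  - by exists A'; split=> //; apply: subset_trans AB.
split=> //.
- by move=> N [A [_ A1 AN]]; exact: AN.
- move=> N FN; have := tM 1%g 1%g; rewrite mulg1 => /(_ _ FN).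
  move=> [[P Q] /= [FP FQ] PQ]; exists (P `&` Q); first exact: filterI.
  by move=> x y [Px _] [_ Qy]; apply: (PQ (x, y)).
- by move=> N; have := tV 1%g; rewrite invg1 => /(_ N).
- move=> k N FN.
  have : nbhs_of_open tau (k^-1 * 1 * k)%g N by rewrite mulg1 mulVg.
  move=> /(tM (k^-1 * 1)%g k)[[P Q] /= [FP FQ] PQ].
  have [[P' Q'] /= [FP' FQ'] PQ'] := tM k^-1%g 1%g P FP.
  apply: filterS FQ' => x Q'x; apply: (PQ (k^-1 * x, k)%g); split=> /=.
    apply: (PQ' (k^-1, x)%g); split=> //=.
    by case: FP' => A [_ A1 AP]; exact: AP.
  by case: FQ => A [_ A1 AP]; exact: AP.
Qed.

Lemma translation_topologyE tau : group_topology tau ->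
  tau = translation_topology (nbhs_of_open tau 1%g).
Proof.
move=> gt; have gF := group_filter_nbhs gt.
have [[tT tI tU] tM tV] := gt.
apply/seteqP; split=> A tA.
- move=> g Ag.
  have : nbhs_of_open tau (g * 1)%g A by rewrite mulg1; exists A; split.
  move=> /(tM g 1%g)[[P Q] /= [[P' [_ P'g P'P]] FQ] PQ].
  have [FF _ _ _ _] := gF; apply: filterS FQ => x Qx.
  by apply: (PQ (g, x)); split=> //=; exact: P'P.
- have -> : A = \bigcup_(C in [set C | tau C /\ C `<=` A]) C.
    apply/seteqP; split=> [g Ag|g [C [_ CA] Cg]]; last exact: CA.
    have: nbhs_of_open tau (g^-1 * g)%g [set x | A (g * x)%g].
      by rewrite mulVg; exact: tA.
    move=> /(tM g^-1%g g)[[P Q] /= [[P' [_ P'g P'P]] [Q' [oQ' Q'g Q'Q]]] PQ].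
    exists Q' => //; split=> // x /Q'Q Qx.
    have /= := PQ (g^-1, x)%g; rewrite mulVKg; apply; split=> //.
    exact: P'P.
  by apply: tU => C [].
Qed.

Lemma translation_topologyS F1 F2 : group_filter F1 -> group_filter F2 ->
  translation_topology F1 `<=` translation_topology F2 <-> F1 `<=` F2.
Proof.
move=> gF1 gF2; split=> [T12|F12 A TA g /TA/F12//].
rewrite -(nbhs_translation1 gF1) -(nbhs_translation1 gF2) => N [A [/T12 TA A1 AN]].
by exists A.
Qed.

Lemma group_topology_subE tau F : group_topology tau -> group_filter F ->
  tau `<=` translation_topology F <-> nbhs_of_open tau 1%g `<=` F.
Proof.
move=> gt gF; rewrite {1}(translation_topologyE gt).
by apply: translation_topologyS => //; exact: group_filter_nbhs.
Qed.

End GroupFilters.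

Lemma smallest_filter_family (X T : Type) (W : T -> set X) (P : set T) (N : set X) :
  smallest (@Filter X) [set W t | t in P] N <->
  exists (K : finType) (t : K -> T), (forall l, P (t l)) /\
    forall x, (forall l, W (t l) x) -> N x.
Proof.
split=> [sN|[K [t [tP tN]]] F [FF WF]]; last first.
  apply: filterS tN _; apply: (@filter_forall _ _ (fun l => W (t l))) => l.
  by apply: WF; exists (t l).
apply: (sN [set N | exists (K : finType) (t : K -> T), (forall l, P (t l)) /\
  forall x, (forall l, W (t l) x) -> N x]); split; last first.
  by move=> _ [t Pt <-]; exists unit, (fun=> t); split=> // x; apply; exact: tt.
split=> [|A B [K [t [tP tA]]] [K' [t' [t'P t'B]]]|A B AB [K [t [tP tA]]]].
- by exists void, (of_void T); split=> // -[].
- exists (K + K')%type, (fun l => match l with inl l => t l | inr l => t' l end).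
  split=> [[]//|x xtt']; split.
    by apply: tA => l; exact: (xtt' (inl l)).
  by apply: t'B => l; exact: (xtt' (inr l)).
- by exists K, t; split=> // x /tA/AB.
Qed.

(** * Amalgamation in the Urysohn space *)

Section FiniteExtrema.
Variables (R : realType) (K : finType).

Lemma fin_min (f : K -> R) (c : R) : exists m,
  [/\ m <= c, forall l, m <= f l & m = c \/ exists l, m = f l].
Proof.
suff [m [mc mf cm]] : exists m, [/\ m <= c, forall l, l \in enum K -> m <= f l
    & m = c \/ exists l, m = f l].
  by exists m; split=> // l; apply: mf; rewrite mem_enum.
elim: (enum K) => [|l s [m [mc mf cm]]]; first by exists c; split=> //; left.
case: (leP m (f l)) => mfl.
  by exists m; split=> // l'; rewrite inE => /predU1P[->//|/mf].
exists (f l); split; last by right; exists l.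
  exact: le_trans (ltW mfl) mc.
by move=> l'; rewrite inE => /predU1P[->//|/mf]; exact/le_trans/ltW.
Qed.

Lemma fin_lb_gt0 (P : K -> Prop) (f : K -> R) : (forall l, P l -> 0 < f l) ->
  exists2 m, 0 < m & forall l, P l -> m <= f l.
Proof.
move=> f0; have [m [_ mf cm]] := fin_min (fun l => if `[< P l >] then f l else 1) 1.
exists m; last by move=> l Pl; have := mf l; rewrite asboolT.
by case: cm => [->//|[l ->]]; case: ifPn => // /asboolP/f0.
Qed.

Lemma fin_ub (f : K -> R) : exists m, forall l, f l <= m.
Proof.
have [m [_ mf _]] := fin_min (fun l => - f l) 0.
by exists (- m) => l; rewrite lerNr.
Qed.

End FiniteExtrema.

Section Urysohn.
Variables (R : realType) (S : set R) (b : \bar R) (U : Type) (d : U -> U -> R).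
Hypothesis S_subgroup : zmod_closed [in S].
Hypothesis S_dense : dense S.
Hypothesis b_bound : b = +oo%E \/ exists r : R, [/\ S r, 0 < r & b = r%:E].
Hypothesis U_urysohn : Sb_urysohn S b d.

Local Notation G := (Isom d).
Local Notation Sb := (Sb_carrier S b).

Lemma S0 : S 0.
Proof. by have [/set_mem] := S_subgroup. Qed.

Lemma SB x y : S x -> S y -> S (x - y).
Proof. by move=> Sx Sy; apply/set_mem; apply: S_subgroup.2; exact/mem_set. Qed.

Lemma SD x y : S x -> S y -> S (x + y).
Proof.
by move=> Sx Sy; rewrite -[y]opprK -(sub0r y); apply: SB => //; exact: SB S0 _.
Qed.

Lemma S_between (x y : R) : x < y -> exists s, [/\ S s, x < s & s < y].
Proof.
move=> xy; have [|z [/=]] := S_dense _ (itv_open x y).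
  by exists ((x + y) / 2); rewrite /= in_itv /= !midf_lt.
by rewrite in_itv /= => /andP[? ?] ?; exists z.
Qed.

Lemma b_gt0 : (0 < b)%E.
Proof. by case: b_bound => [->|[r [_ r0 ->]]]//; rewrite lte_fin. Qed.

Lemma Sb0 : Sb 0.
Proof. by split=> //; [exact: S0|exact/ltW/b_gt0]. Qed.

Lemma SbB x y : Sb x -> Sb y -> y <= x -> Sb (x - y).
Proof.
move=> [Sx x0 xb] [Sy y0 yb] yx; split; [exact: SB|by rewrite subr_ge0|].
by apply: le_trans xb; rewrite lee_fin gerBl.
Qed.

Lemma SbD x y : Sb x -> Sb y -> ((x + y)%:E <= b)%E -> Sb (x + y).
Proof.
by move=> [Sx x0 xb] [Sy y0 yb] xyb; split=> //; [exact: SD|exact: addr_ge0].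
Qed.

Lemma leb_trans (x y : R) : x <= y -> (y%:E <= b)%E -> (x%:E <= b)%E.
Proof. by move=> xy; apply: le_trans; rewrite lee_fin. Qed.

Lemma ltb_trans (x y : R) : x < y -> (y%:E <= b)%E -> (x%:E < b)%E.
Proof. by move=> xy; apply: lt_le_trans; rewrite lte_fin. Qed.

Lemma leb_ltb_trans (x y : R) : x <= y -> (y%:E < b)%E -> (x%:E < b)%E.
Proof. by move=> xy; apply: le_lt_trans; rewrite lee_fin. Qed.

Lemma ltb_gap (x : R) : (x%:E < b)%E -> exists2 e, 0 < e & ((x + e)%:E <= b)%E.
Proof.
case: b_bound => [->|[r [_ _ ->]]]; first by exists 1; rewrite ?leey.
by rewrite lte_fin => xr; exists (r - x); rewrite ?subr_gt0// addrC subrK.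
Qed.

Lemma Sb_gt0_lt (e : R) : 0 < e -> exists s, [/\ Sb s, 0 < s & s < e].
Proof.
move=> e0; have [e' e'0] := ltb_gap b_gt0; rewrite add0r => e'b.
have [|s [Ss s0]] := @S_between 0 (Num.min e e').
  by rewrite lt_min e0.
rewrite lt_min => /andP[se se'].
exists s; split=> //; split=> //; first exact: ltW.
by apply: leb_trans e'b; exact: ltW.
Qed.

Lemma Sb_cap (M : R) : exists c, [/\ Sb c, 0 < c,
  forall x, (x%:E <= b)%E -> x <= M -> x <= c & M <= c \/ c%:E = b].
Proof.
case: b_bound => [->|[r [Sr r0 ->]]].
  have [|c [Sc Mc _]] := @S_between (Num.max M 0) (Num.max M 0 + 1).
    by rewrite ltrDl.
  move: Mc; rewrite gt_max => /andP[Mc c0].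
  exists c; split=> //; first by split=> //; [exact: ltW|exact: leey].
    by move=> x _ /le_trans; apply; exact: ltW.
  by left; exact: ltW.
exists r; split=> //; last by right.
by split=> //; exact: ltW.
Qed.

Lemma Sb_addE (x y z : R) : (z%:E <= b)%E -> (z <= Sb_add b x y) = (z <= x + y).
Proof.
rewrite /Sb_add; case: b_bound => [->|[r [_ _ ->]]]; first by rewrite min_l ?leey.
by rewrite lee_fin => zr; rewrite -EFin_min /= le_min zr andbT.
Qed.

Lemma dSb x y : Sb (d x y). Proof. by have [[]] := U_urysohn. Qed.
Lemma dxx x : d x x = 0. Proof. by have [[_ /(_ x x)[_ ->]]] := U_urysohn. Qed.
Lemma d_eq0 x y : d x y = 0 -> x = y.
Proof. by have [[_ /(_ x y)[]]] := U_urysohn. Qed.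
Lemma dC x y : d x y = d y x. Proof. by have [[]] := U_urysohn. Qed.
Lemma d_ge0 x y : 0 <= d x y. Proof. by have [] := dSb x y. Qed.
Lemma d_leb x y : ((d x y)%:E <= b)%E. Proof. by have [] := dSb x y. Qed.
Lemma d_tri y x z : d x z <= d x y + d y z.
Proof. by rewrite -Sb_addE ?d_leb//; have [[]] := U_urysohn. Qed.

Section Pseudometric.
Variables (T : finType) (D : T -> T -> R).
Hypotheses (D_Sb : forall x y, Sb (D x y)) (Dxx : forall x, D x x = 0).
Hypotheses (DC : forall x y, D x y = D y x).
Hypothesis D_tri : forall x y z, D x z <= D x y + D y z.

Let D_ge0 x y : 0 <= D x y. Proof. by have [] := D_Sb x y. Qed.

Lemma pseudometric_embed : exists f : T -> U, forall x y, d (f x) (f y) = D x y.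
Proof.
have ex x : exists y, D x y == 0 by exists x; rewrite Dxx.
pose r x := xchoose (ex x).
have Dr x : D x (r x) = 0 by apply/eqP; exact: (xchooseP (ex x)).
have D0 x y z : D x y = 0 -> D x z = D y z.
  move=> xy0; apply/eqP; rewrite eq_le; apply/andP; split.
    by have := D_tri x y z; rewrite xy0 add0r.
  by have := D_tri y x z; rewrite (DC y x) xy0 add0r.
have r_eq x y : D x y = 0 -> r x = r y.
  by move=> /D0 xy; apply: eq_xchoose => z; rewrite xy.
have rr x : r (r x) == r x by apply/eqP; apply/esym/r_eq/Dr.
pose T' := {x : T | r x == x}.
pose D' (x y : T') := D (val x) (val y).
have [_ emb _] := U_urysohn.
have [|f fD] := emb T' D'.
  split=> [x y|x y|x y|x y z].
  - exact: D_Sb.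
  - split=> [xy|->]; last exact: Dxx.
    apply: val_inj; rewrite -(eqP (valP x)) -(eqP (valP y)) /=.
    exact: r_eq.
  - exact: DC.
  - rewrite Sb_addE; first exact: D_tri.
    by have [] := D_Sb (val x) (val z).
exists (fun x => f (exist _ (r x) (rr x) : T')) => x y.
by rewrite fD /D' /= -(D0 _ _ _ (Dr x)) DC -(D0 _ _ _ (Dr y)) DC.
Qed.

End Pseudometric.

Lemma homogeneous (K : finType) (x y : K -> U) :
  (forall i j, d (x i) (x j) = d (y i) (y j)) ->
  exists g : G, forall i, g (x i) = y i.
Proof.
move=> xy.
have [|f fxy] := @choice U U (fun u v => forall i, x i = u -> v = y i).
  move=> u; have [[i xi]|xu] := pselect (exists i, x i = u).
    exists (y i) => j xj; apply: d_eq0.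
    by rewrite -xy xi xj dxx.
  by exists u => i xi; case: xu; exists i.
have [_ _ hom] := U_urysohn.
have [|u v|g gf] := hom (range x) f.
- exact: finite_image finite_finset.
- by move=> /set_mem[i _ <-] /set_mem[j _ <-]; rewrite !(fxy _ _ erefl) xy.
by exists g => i; rewrite gf ?(fxy _ _ erefl)//; apply/mem_set; exists i.
Qed.

Lemma extend_metric (T : finType) (P : pred T) (D : T -> T -> R) (e : T -> U) :
  (forall x y, Sb (D x y)) -> (forall x, D x x = 0) ->
  (forall x y, D x y = D y x) -> (forall x y z, D x z <= D x y + D y z) ->
  (forall x y, P x -> P y -> d (e x) (e y) = D x y) ->
  exists f : T -> U, (forall x y, d (f x) (f y) = D x y) /\
    forall x, P x -> f x = e x.
Proof.
move=> D_Sb Dxx DC D_tri eD.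
have [f fD] := pseudometric_embed D_Sb Dxx DC D_tri.
have [|g gf] := @homogeneous {x | P x} (fun x => f (val x)) (fun x => e (val x)).
  by move=> x y; rewrite fD eD //; exact: valP.
exists (fun x => g (f x)); split=> [x y|x Px]; first by rewrite isom_dist.
exact: (gf (exist _ x Px)).
Qed.

Lemma katetov_extension (K : finType) (x : K -> U) (f : K -> R) :
  (forall l, Sb (f l)) -> (forall l m, f l <= f m + d (x l) (x m)) ->
  (forall l m, d (x l) (x m) <= f l + f m) ->
  exists w, forall l, d w (x l) = f l.
Proof.
move=> fSb f1 f2.
have f0 l : 0 <= f l by have [] := fSb l.
pose D (l m : option K) := match l, m with
  | Some l, Some m => d (x l) (x m) | None, Some m => f m
  | Some l, None => f l | None, None => 0 end.
have [w _] := @pseudometric_embed unit (fun _ _ => 0) (fun _ _ => Sb0)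
  (fun=> erefl) (fun _ _ => erefl) (fun _ _ _ => ler_wpDr (lexx 0) (lexx 0)).
have [| | | | |h [hD hx]] :=
    @extend_metric (option K) (fun l => l : bool) D (fun l => oapp x (w tt) l).
- by move=> [l|] [m|] //=; [exact: dSb|exact: Sb0].
- by move=> [l|] //=; exact: dxx.
- by move=> [l|] [m|] //=; exact: dC.
- move=> [l|] [m|] [n|] //=; rewrite ?add0r ?addr0 //.
  + exact: d_tri.
  + by rewrite addrC.
  + by rewrite dC.
  + exact: addr_ge0.
- by move=> [l|] [m|].
by exists (h None) => l; have /= <- := hx (Some l) isT; rewrite hD.
Qed.

Section Amalgam.
Variables (I J K : finType) (p : I -> U) (q : J -> U) (x : K -> U).

Lemma amalgam (D : I -> J -> R) :
  (forall i j, Sb (D i j)) ->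
  (forall i i' j, D i j <= d (p i) (p i') + D i' j) ->
  (forall i i' j, d (p i) (p i') <= D i j + D i' j) ->
  (forall i j j', D i j <= D i j' + d (q j') (q j)) ->
  (forall i j j', d (q j) (q j') <= D i j + D i j') ->
  (forall i j l, D i j <= d (p i) (x l) + d (x l) (q j)) ->
  (forall i j l, d (p i) (x l) <= D i j + d (q j) (x l)) ->
  (forall i j l, d (q j) (x l) <= D i j + d (p i) (x l)) ->
  exists k : G, (forall l, k (x l) = x l) /\
    forall i j, d (k (p i)) (q j) = D i j.
Proof.
move=> DSb Dp1 Dp2 Dq1 Dq2 Dx1 Dx2 Dx3.
pose e (t : K + J + I) :=
  match t with inl (inl l) => x l | inl (inr j) => q j | inr i => p i end.
pose D' (s t : K + J + I) := match s, t with
  | inr i, inl (inr j) => D i j | inl (inr j), inr i => D i j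
  | _, _ => d (e s) (e t) end.
have D'C s t : D' s t = D' t s by case: s t => [[l|j]|i] [[l'|j']|i'] //=; exact: dC.
have [| | | |f [fD fe]] := @extend_metric _
    (fun t => if t is inl _ then true else false) D' e _ _ D'C.
- by move=> [[l|j]|i] [[l'|j']|i'] //=; exact: dSb.
- by move=> [[l|j]|i] //=; exact: dxx.
- move=> [[l|j]|i] [[l'|j']|i'] [[l''|j'']|i''] //=; try exact: d_tri.
  + by rewrite addrC dC (dC (x l)); exact: Dx2.
  + by rewrite addrC dC (dC (x l)); exact: Dx3.
  + by rewrite addrC dC (dC (q j)); exact: Dx1.
  + by rewrite addrC dC; exact: Dq1.
  + by rewrite addrC (dC (p i')); exact: Dp1.
- by move=> [[l|j]|i] [[l'|j']|i'].
have [|k kf] := @homogeneous (K + I)%type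
    (fun t => match t with inl l => x l | inr i => p i end)
    (fun t => match t with inl l => x l | inr i => f (inr i) end).
  move=> [l|i] [l'|i'] //=.
  - by have /= fl := fe (inl (inl l)) isT; rewrite -[in RHS]fl fD.
  - by have /= fl := fe (inl (inl l')) isT; rewrite -[in RHS]fl fD.
exists k; split=> [l|i j]; first exact: (kf (inl l)).
by rewrite (kf (inr i)); have /= <- := fe (inl (inr j)) isT; rewrite fD.
Qed.

Lemma free_amalgam (r : R) : exists k : G, (forall l, k (x l) = x l) /\
  forall i j, (exists l, d (k (p i)) (q j) = d (p i) (x l) + d (x l) (q j)) \/
    r <= d (k (p i)) (q j) \/ (d (k (p i)) (q j))%:E = b.
Proof.
pose e (t : K + J + I) :=
  match t with inl (inl l) => x l | inl (inr j) => q j | inr i => p i end.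
have [B Bub] := fin_ub (fun st => d (e st.1) (e st.2)).
have [c [cSb c0 Bc rc]] := Sb_cap (Num.max B r).
have dc s t : d (e s) (e t) <= c.
  by apply: Bc; [exact: d_leb|rewrite le_max (Bub (s, t))].
have [D DP] := choice (fun ij : I * J =>
  fin_min (fun l => d (p ij.1) (x l) + d (x l) (q ij.2)) c).
have Dc i j : D (i, j) <= c by have [] := DP (i, j).
have Dle i j l : D (i, j) <= d (p i) (x l) + d (x l) (q j).
  by have [_ /(_ l)] := DP (i, j).
have Dcase i j : D (i, j) = c \/ exists l, D (i, j) = d (p i) (x l) + d (x l) (q j).
  by have [] := DP (i, j).
have D0 i j : 0 <= D (i, j).
  by case: (Dcase i j) => [->|[l ->]]; [exact: ltW|rewrite addr_ge0 ?d_ge0].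
have [k [kx kD]] : exists k : G, (forall l, k (x l) = x l) /\
    forall i j, d (k (p i)) (q j) = D (i, j).
  apply: amalgam => // [i j|i i' j|i i' j|i j j'|i j j'|i j l|i j l].
  - case: (Dcase i j) => [->//|[l Dl]]; rewrite Dl.
    apply: SbD; [exact: dSb|exact: dSb|].
    by rewrite -Dl; apply: leb_trans (Dc i j) _; have [] := cSb.
  - case: (Dcase i' j) => [->|[l ->]].
      by rewrite (le_trans (Dc _ _))// lerDr d_ge0.
    by rewrite (le_trans (Dle _ _ l))// addrA lerD2r d_tri.
  - have dpp := dc (inr i) (inr i'); rewrite /= in dpp.
    case: (Dcase i j) => [->|[l ->]]; first by rewrite (le_trans dpp)// lerDl.
    case: (Dcase i' j) => [->|[l' ->]].
      by rewrite (le_trans dpp)// lerDr addr_ge0 ?d_ge0.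
    have := d_tri (q j) (p i) (p i'); have := d_tri (x l) (p i) (q j).
    by have := d_tri (x l') (p i') (q j); rewrite (dC (q j) (p i')); lra.
  - case: (Dcase i j') => [->|[l ->]].
      by rewrite (le_trans (Dc _ _))// lerDl d_ge0.
    by rewrite (le_trans (Dle _ _ l))// -addrA lerD2l d_tri.
  - have dqq := dc (inl (inr j)) (inl (inr j')); rewrite /= in dqq.
    case: (Dcase i j) => [->|[l ->]]; first by rewrite (le_trans dqq)// lerDl.
    case: (Dcase i j') => [->|[l' ->]].
      by rewrite (le_trans dqq)// lerDr addr_ge0 ?d_ge0.
    have := d_tri (p i) (q j) (q j'); have := d_tri (x l) (p i) (q j).
    by have := d_tri (x l') (p i) (q j'); rewrite (dC (q j) (p i)); lra.
  - case: (Dcase i j) => [->|[l' ->]].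
      by rewrite (le_trans (dc (inr i) (inl (inl l))))// lerDl d_ge0.
    have := d_tri (x l') (p i) (x l); have := d_tri (q j) (x l') (x l).
    by lra.
  - case: (Dcase i j) => [->|[l' ->]].
      by rewrite (le_trans (dc (inl (inr j)) (inl (inl l))))// lerDl d_ge0.
    have := d_tri (x l') (q j) (x l); have := d_tri (p i) (x l') (x l).
    by rewrite (dC (q j) (x l')) (dC (x l') (p i)); lra.
exists k; split=> // i j; rewrite kD; case: (Dcase i j) => [->|]; [right|by left].
by case: rc => [|->]; [rewrite ge_max => /andP[_ ?]; left|right].
Qed.

End Amalgam.

Lemma isomM (g h : G) x : (g * h)%g x = g (h x). Proof. by []. Qed.
Lemma isom1 x : (1%g : G) x = x. Proof. by []. Qed.
Lemma isomK (g : G) x : g^-1%g (g x) = x. Proof. exact: isom_invK. Qed.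
Lemma isomVK (g : G) x : g (g^-1%g x) = x. Proof. exact: isom_invKV. Qed.
Lemma dVl (g : G) x y : d (g^-1%g x) y = d x (g y).
Proof. by rewrite -(isom_dist g) isomVK. Qed.
Lemma dVr (g : G) x y : d x (g^-1%g y) = d (g x) y.
Proof. by rewrite dC dVl dC. Qed.

Lemma homogeneous1 u v : exists g : G, g u = v.
Proof.
have [|g gu] := @homogeneous unit (fun=> u) (fun=> v); first by rewrite !dxx.
by exists g; exact: gu tt.
Qed.

Lemma homogeneous2 u v u' v' : d u v = d u' v' -> exists g : G, g u = u' /\ g v = v'.
Proof.
move=> duv; have [|g guv] := @homogeneous bool (fun i => if i then u else v)
    (fun i => if i then u' else v').
  by case; case; rewrite ?dxx// dC duv dC.
by exists g; split; [exact: guv true|exact: guv false].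
Qed.

Lemma family_seq (K : finType) (x : K -> U) : exists s, forall l, List.In (x l) s.
Proof.
exists [seq x l | l <- enum K] => l; apply: List.in_map.
by have := mem_enum K l; elim: (enum K) => //= a s IHs;
  rewrite inE => /predU1P[->|/IHs]; [left|right].
Qed.

Lemma seq_family (s : seq U) : exists (K : finType) (x : K -> U),
  forall y, List.In y s <-> exists l, x l = y.
Proof.
elim: s => [|a s [K [x xs]]].
  by exists void, (of_void U) => y; split=> // -[[]].
exists (option K), (fun i => if i is Some l then x l else a) => y; split.
  by case=> [->|/xs[l <-]]; [exists None|exists (Some l)].
by case=> -[l <-|<-]; [right; apply/xs; exists l|left].
Qed.

(** * Filters coarser than the stabilizer filter *)

Section GroupFilter.
Variable F : set_system G.
Hypothesis F_group : group_filter F.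
Hypothesis F_st : forall N, F N -> exists (K : finType) (x : K -> U),
  forall g : G, (forall l, g (x l) = x l) -> N g.

#[local] Instance F_filter : Filter F. Proof. by have [] := F_group. Qed.

Lemma F_one N : F N -> N 1%g. Proof. by have [_ H _ _ _] := F_group; exact: H. Qed.

Lemma F_mul N : F N -> exists2 V, F V & forall x y, V x -> V y -> N (x * y)%g.
Proof. by have [_ _ H _ _] := F_group; exact: H. Qed.

Lemma F_inv N : F N -> F [set x | N x^-1%g].
Proof. by have [_ _ _ H _] := F_group; exact: H. Qed.

Lemma F_conj k N : F N -> F [set x | N (k^-1 * x * k)%g].
Proof. by have [_ _ _ _ H] := F_group; exact: H. Qed.

Lemma F_forall_in (K : finType) (P : pred K) (A : K -> set G) :
  (forall l, P l -> F (A l)) -> F [set h : G | forall l, P l -> A l h].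
Proof.
move=> FA; apply: (@filter_forall _ _ (fun l => [set h : G | P l -> A l h])) => l.
case: (boolP (P l)) => [/FA|_]; first by apply: filterS => h hA _.
by apply: filterS filterT => h _.
Qed.

(* With [G_x] the pointwise stabilizer of [x] and [h1], [h2] in [V], the products
   [k1 * h2^-1 * k * h1 * k2] with [k], [k1], [k2] in [G_x] are the isometries [g]
   for which the distances from [g x] to [x] are those from [k h1 x] to [h2 x]. *)
Lemma double_coset N (K0 : finType) (y : K0 -> U) : F N ->
  exists V (K : finType) (x : K -> U), [/\ F V, forall i, exists l, x l = y i
    & forall h1 h2 k g : G, V h1 -> V h2 -> (forall l, k (x l) = x l) ->
        (forall i j, d (g (x i)) (x j) = d (k (h1 (x i))) (h2 (x j))) -> N g].
Proof.
move=> /F_mul[V1 /F_mul[V2 /F_mul[V3 FV3 V32] V21] V1N].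
have [K [x xV]] := F_st FV3.
pose x' (i : K + K0) := match i with inl l => x l | inr i => y i end.
exists (V3 `&` [set g | V3 g^-1%g]), (K + K0)%type, x'; split.
- exact: filterI (F_inv FV3).
- by move=> i; exists (inr i).
move=> h1 h2 k g [V3h1 _] [_ V3h2] kx gkh.
pose g' := (h2^-1 * (k * h1))%g.
have g'E i j : d (g' (x' i)) (x' j) = d (g (x' i)) (x' j) by rewrite /g' isomM dVl gkh.
have [|k1 k1E] := @homogeneous ((K + K0) + (K + K0))%type
    (fun t => match t with inl l => x' l | inr l => g' (x' l) end)
    (fun t => match t with inl l => x' l | inr l => g (x' l) end).
  by move=> [i|i] [j|j]//; rewrite ?isom_dist// dC g'E dC.
have V3k1 : V3 k1 by apply: xV => l; exact: (k1E (inl (inl l))).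
pose k2 := ((k1 * g')^-1 * g)%g.
have V3k2 : V3 k2.
  apply: xV => l; rewrite /k2 isomM -(k1E (inr (inl l))) -isomM; exact: isomK.
have -> : g = ((k1 * h2^-1) * (k * h1) * k2)%g.
  by rewrite /k2 mulgA -(mulgA k1) -/g' mulgV mul1g.
have V31 := F_one FV3.
apply: V1N; first by apply: V21; apply: V32 => //; apply: xV => l; exact: (kx (inl l)).
rewrite -[k2]mulg1; apply: V21; last by rewrite -[1%g]mulg1; exact: V32.
by rewrite -[k2]mulg1; exact: V32.
Qed.

Section NonMetric.
Variables (u0 : U) (e0 : R).
Hypothesis e0_gt0 : 0 < e0.
Hypothesis u0_ball : ~ F (displacement_ball d u0 e0).

Let far delta := forall V, F V -> forall (I K : finType) (y : I -> U) (x : K -> U),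
  exists2 h, V h & forall i l, delta <= d (h (y i)) (x l).

Let far_single delta V (K : finType) (x : K -> U) v :
  delta + delta <= e0 -> ((delta + delta)%:E <= b)%E -> F V ->
  exists2 h, V h & forall l, delta <= d (h v) (x l).
Proof.
move=> de db FV; apply: contrapT => noh; apply: u0_ball.
have {noh} near_x h : V h -> exists l, d (h v) (x l) < delta.
  move=> Vh; apply: contrapT => nol; apply: noh; exists h => // l.
  by rewrite leNgt; apply/negP => hl; apply: nol; exists l.
have [c cu0] := homogeneous1 v u0.
have [k [kv kx]] := free_amalgam x x (fun _ : unit => v) (delta + delta).
suff /(F_conj c) : F [set h | d (h v) v <= e0].
  apply: filterS => h.
  change (d (c^-1%g (h (c v))) v <= e0 -> d (h u0) u0 <= e0).
  by rewrite cu0 dVl cu0.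
apply: filterS (filterI FV (F_conj k FV)) => h [/near_x[l hl]] /near_x[l'].
rewrite !isomM dVl (kv tt) => hl'.
have lt2 : d (k (x l')) (x l) < delta + delta.
  by have := d_tri (h v) (k (x l')) (x l); rewrite (dC _ (h v)); lra.
rewrite /=; case: (kx l' l) => [[_ kE]|[|kb]].
- have := d_tri (x l) (h v) v; have := d_tri (k (x l')) (h v) v.
  rewrite -[in d (k (x l')) v](kv tt) isom_dist (dC (x l) v).
  rewrite kE in lt2; case: (ltP (d (x l') v) delta); lra.
- by rewrite leNgt lt2.
- by move: db; rewrite -kb lee_fin leNgt lt2.
Qed.

Let far_start delta : delta + delta <= e0 -> ((delta + delta)%:E <= b)%E ->
  0 <= delta -> far delta.
Proof.
move=> de db d0 V FV I K y x.
have [s ys] := family_seq y.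
suff [h Vh hs] : exists2 h, V h &
    forall z, List.In z s -> forall l, delta <= d (h z) (x l).
  by exists h => // i l; exact: hs.
elim: s K x V FV {y ys} => [|a s IHs] K x V FV.
  by exists 1%g => //; exact: F_one.
have [V1 /F_mul[V2 FV2 V21] V1V] := F_mul FV.
have [K' [x' x'V]] := F_st FV2.
pose w := fun l : K + K' => match l with inl l => x l | inr l => x' l end.
have [h1 Vh1 h1s] := IHs _ w _ FV2.
have [h2 Vh2 h2a] := far_single x (h1 a) de db FV2.
have [I' [z zs]] := seq_family s.
have [k [kw kz]] := free_amalgam (fun i => h1 (z i)) (fun l => h2^-1%g (x l))
  (fun l => if l is Some l then w l else h1 a) delta.
have Vk : V2 k by apply: x'V => l; exact: (kw (Some (inr l))).
exists (h2 * (k * h1))%g.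
  rewrite -[h2]mulg1; apply: V1V; last exact: V21.
  by apply: V21 => //; exact: F_one.
move=> y' [<-|/zs[i <-]] l.
  by rewrite !isomM (kw None).
rewrite !isomM -dVr; case: (kz i l) => [[[m|] ->]|[//|kb]].
- by rewrite (le_trans (h1s (z i) _ m)) ?lerDl ?d_ge0//; apply/zs; exists i.
- by rewrite dVr (le_trans (h2a l))// lerDr d_ge0.
- by rewrite -lee_fin kb; apply: le_trans db; rewrite lee_fin lerDl.
Qed.

Let far_double delta delta' : far delta -> delta' <= delta + delta ->
  (delta'%:E <= b)%E -> far delta'.
Proof.
move=> fard dd db V FV I K y x.
have [V' [K' [w [FV' yxw V'V]]]] := double_coset
  (fun t : I + K => match t with inl i => y i | inr l => x l end) FV.
have [h1 Vh1 h1w] := fard _ FV' _ _ w w.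
have [k [kw kh]] := free_amalgam (fun i => h1 (w i)) (fun l => h1 (w l)) w delta'.
exists (h1^-1 * (k * h1))%g.
  by apply: (V'V h1 h1 k) => // i j; rewrite isomM dVl.
move=> i l; have [i' <-] := yxw (inl i); have [l' <-] := yxw (inr l).
rewrite isomM dVl isomM; case: (kh i' l') => [[m ->]|[//|kb]]; last first.
  by rewrite -lee_fin kb.
apply: le_trans dd _; rewrite lerD// ?h1w// dC; exact: h1w.
Qed.

Let far_all delta : (delta%:E <= b)%E -> far delta.
Proof.
have [s [[_ _ sb] s0 se]] := Sb_gt0_lt e0_gt0.
have s20 : 0 < s / 2 by rewrite divr_gt0.
suff far_pow n eta : eta <= 2 ^+ n * (s / 2) -> (eta%:E <= b)%E -> far eta.
  apply: (far_pow (Num.bound (delta / (s / 2)))).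
  by rewrite -ler_pdivrMr//; exact/ltW/upper_nthrootP.
elim: n eta => [|n IHn] eta etan etab.
  apply: (@far_double (s / 2)) => //.
    by apply: far_start; rewrite -?splitr// ltW.
  by move: etan; rewrite expr0 mul1r; lra.
case: (leP eta 0) => eta0.
  move=> V FV I K y x; exists 1%g => [|i l]; first exact: F_one.
  exact: le_trans (d_ge0 _ _).
apply: (@far_double (eta / 2)); rewrite -?splitr//; apply: IHn.
  by move: etan; rewrite exprS; lra.
by apply: leb_trans etab; lra.
Qed.

Lemma nonmetric_trivial N (g : G) : F N -> N g.
Proof.
move=> /F_mul[V1 FV1 V1N].
have FV1' : F (V1 `&` [set x | V1 x^-1%g]) by exact: filterI (F_inv FV1).
have [V [K [x [FV _ VV1]]]] := double_coset (of_void U) FV1'.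
pose q (l : K + K) := match l with inl l => x l | inr l => g (x l) end.
have [c cSb cub] : exists2 c, Sb c & forall i j, d (x i) (q j) <= c.
  have [m [_ mf cm]] := fin_min (fun ij : K * (K + K) => - d (x ij.1) (q ij.2)) 0.
  exists (- m); last by move=> i j; rewrite lerNr; exact: mf (i, j).
  by case: cm => [->|[ij ->]]; rewrite ?oppr0 ?opprK; [exact: Sb0|exact: dSb].
have [_ c0 cb] := cSb.
have [h Vh hx] := far_all cb FV x x.
have xc i j : d (x i) (x j) <= c by exact: cub i (inl j).
have [k [kx kc]] : exists k : G, (forall l, k (x l) = x l) /\
    forall i j, d (k (h (x i))) (h (x j)) = c.
  apply: amalgam => [i j|i i' j|i i' j|i j j'|i j j'|i j l|i j l|i j l] //.
  - by rewrite lerDr d_ge0.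
  - by rewrite isom_dist (le_trans (xc _ _))// lerDl.
  - by rewrite lerDl d_ge0.
  - by rewrite isom_dist (le_trans (xc _ _))// lerDl.
  - by rewrite (le_trans (hx i l))// lerDl d_ge0.
  - rewrite (le_trans (d_tri (h (x j)) _ _))// isom_dist lerD2r; exact: xc.
  - rewrite (le_trans (d_tri (h (x i)) _ _))// isom_dist lerD2r; exact: xc.
have V1c (m : G) : (forall i j, d (m (x i)) (x j) = c) -> V1 m /\ V1 m^-1%g.
  by move=> mc; apply: (VV1 h h k) => // i j; rewrite mc kc.
have [m [_ mc]] : exists m : G, (forall l : void, m (of_void U l) = of_void U l) /\
    forall i j, d (m (x i)) (q j) = c.
  apply: amalgam => [i j|i i' j|i i' j|i j j'|i j j'|i j []|i j []|i j []] //.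
  - by rewrite lerDr d_ge0.
  - by rewrite (le_trans (xc _ _))// lerDl.
  - by rewrite lerDl d_ge0.
  - apply: (@le_trans _ _ c); last by rewrite lerDl.
    case: j j' => [j|j] [j'|j'] /=; rewrite ?isom_dist; first exact: xc.
    + exact: cub j (inr j').
    + rewrite dC; exact: cub j' (inr j).
    + exact: xc.
have [V1m _] := V1c m (fun i j => mc i (inl j)).
have [|_ V1m'] := V1c (g^-1 * m)%g.
  by move=> i j; rewrite isomM dVl (mc i (inr j)).
have <- : (m * (g^-1 * m)^-1 = g)%g by rewrite invgM invgK mulgA mulgV mul1g.
exact: V1N.
Qed.

End NonMetric.
Lemma point_at u v s t : Sb s -> Sb t -> s <= t + d u v -> t <= s + d u v ->
  d u v <= s + t -> exists w, d u w = s /\ d v w = t.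
Proof.
move=> sSb tSb st ts uv.
have [[]|[]||w wE] := @katetov_extension bool (fun i => if i then u else v)
    (fun i => if i then s else t) => //.
- by case=> //=; rewrite dxx addr0.
- by case=> //=; rewrite ?dxx ?addr0// dC.
- have [_ s0 _] := sSb; have [_ t0 _] := tSb.
  by case; case=> //=; rewrite ?dxx ?addr_ge0// dC addrC.
by exists w; split; rewrite dC; [exact: wE true|exact: wE false].
Qed.

(** * Filters finer than the displacement filter *)

Section MetricFilter.
Hypothesis F_ball : forall u (e : R), 0 < e -> F (displacement_ball d u e).

Lemma F_lt f x c : d f x < c -> F [set h | d (h f) x < c].
Proof.
move=> fxc; have : F (displacement_ball d f ((c - d f x) / 2)).
  by apply: F_ball; rewrite divr_gt0 ?subr_gt0.
by apply: filterS => h; rewrite /displacement_ball /=; have := d_tri f (h f) x; lra.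
Qed.

Lemma F_gt f x c : c < d f x -> F [set h | c < d (h f) x].
Proof.
move=> fxc; have : F (displacement_ball d f ((d f x - c) / 2)).
  by apply: F_ball; rewrite divr_gt0 ?subr_gt0.
apply: filterS => h; rewrite /displacement_ball /=.
by have := d_tri (h f) f x; rewrite (dC f (h f)); lra.
Qed.

Definition upper_nbhd u v := F [set h | d (h u) v <= d u v].
Definition lower_nbhd u v := F [set h | d u v <= d (h u) v].

Lemma upper_nbhd_eq u v u' v' : d u v = d u' v' -> upper_nbhd u v -> upper_nbhd u' v'.
Proof.
move=> duv; have [k [<- <-]] := homogeneous2 duv.
move=> /(F_conj k); rewrite /upper_nbhd isom_dist; apply: filterS => h.
change (d (k^-1%g (h (k u))) v <= d u v -> d (h (k u)) (k v) <= d u v).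
by rewrite dVl.
Qed.

Lemma lower_nbhd_eq u v u' v' : d u v = d u' v' -> lower_nbhd u v -> lower_nbhd u' v'.
Proof.
move=> duv; have [k [<- <-]] := homogeneous2 duv.
move=> /(F_conj k); rewrite /lower_nbhd isom_dist; apply: filterS => h.
change (d u v <= d (k^-1%g (h (k u))) v -> d u v <= d (h (k u)) (k v)).
by rewrite dVl.
Qed.

Lemma upper_nbhd_ge u v u' v' : d u v <= d u' v' -> upper_nbhd u v -> upper_nbhd u' v'.
Proof.
move=> duv uvF.
have uvSb : Sb (d u' v' - d u v) by apply: SbB => //; exact: dSb.
have [w [uw vw]] : exists w, d u' w = d u v /\ d v' w = d u' v' - d u v.
  by apply: point_at; rewrite ?d_ge0//; [exact: dSb|have := d_ge0 u v; lra..].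
apply: filterS (upper_nbhd_eq (esym uw) uvF) => h /=.
by have := d_tri w (h u') v'; rewrite (dC w); lra.
Qed.

Lemma lower_nbhd_le u v u' v' : d u' v' <= d u v -> lower_nbhd u v -> lower_nbhd u' v'.
Proof.
move=> duv uvF.
have uvSb : Sb (d u v - d u' v') by apply: SbB => //; exact: dSb.
have [w [uw vw]] : exists w, d u' w = d u v /\ d v' w = d u v - d u' v'.
  by apply: point_at; rewrite ?d_ge0//; [exact: dSb|have := d_ge0 u' v'; lra..].
apply: filterS (lower_nbhd_eq (esym uw) uvF) => h /=.
by have := d_tri v' (h u') w; lra.
Qed.

Lemma upper_lower_nbhd u v u' v' : ((d u v + d u' v')%:E <= b)%E ->
  upper_nbhd u v -> lower_nbhd u' v'.
Proof.
move=> duvb uvF.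
have uvSb : Sb (d u v + d u' v') by apply: SbD => //; exact: dSb.
have [w [uw vw]] : exists w, d u' w = d u v /\ d v' w = d u v + d u' v'.
  apply: point_at => //; first exact: dSb.
    by have := d_ge0 u' v'; lra.
  by have := d_ge0 u v; lra.
apply: filterS (upper_nbhd_eq (esym uw) uvF) => h /=.
by have := d_tri (h u') v' w; rewrite (dC v' (h u')); lra.
Qed.

(* Once a condition holds it survives left multiplication by elements close to
   the identity, so that finitely many conditions can be achieved one by one. *)
Lemma achieve_open (K : finType) (a : K -> U) (C : K -> set U) V :
  (forall l f, C l f -> F [set h | C l (h f)]) ->
  (forall l f V, F V -> exists2 h, V h & C l (h f)) ->
  F V -> exists2 h, V h & forall l, C l (h (a l)).
Proof.
move=> C_open C_ex FV.
suff [h Vh hC] : exists2 h, V h & forall l, l \in enum K -> C l (h (a l)).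
  by exists h => // l; apply: hC; rewrite mem_enum.
elim: (enum K) V FV => [|l0 s IHs] V FV; first by exists 1%g => //; exact: F_one.
have [V1 FV1 V1V] := F_mul FV.
have [h1 Vh1 h1C] := IHs _ FV1.
have /(C_ex l0 (h1 (a l0)))[h2 [Vh2 h2C] h2l0] :
    F (V1 `&` [set h : G | forall l, l \in s -> C l (h (h1 (a l)))]).
  apply: filterI => //.
  apply: (F_forall_in (P := fun l => l \in s)
    (A := fun l => [set h : G | C l (h (h1 (a l)))])) => l /h1C; exact: C_open.
exists (h2 * h1)%g; first exact: V1V.
by move=> l; rewrite inE => /predU1P[->|/h2C].
Qed.

Lemma sub_partial_distance N : (forall a, ~ upper_nbhd a a) -> F N ->
  exists (K : finType) (u v : K -> U),
    (forall l, 0 < d (u l) (v l) /\ ((d (u l) (v l))%:E < b)%E) /\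
    forall g : G, (forall l, d (g (u l)) (v l) = d (u l) (v l)) -> N g.
Proof.
move=> noaa /(double_coset (of_void U))[V [K [x [FV _ VN]]]].
have [||h Vh hx] := achieve_open (fun ij : K * K => x ij.1)
    (C := fun ij => [set f | 0 < d f (x ij.2)]) _ _ FV.
- by move=> ij f /= /F_gt.
- move=> ij f V' FV'; case: (ltP 0 (d f (x ij.2))) => fx.
    by exists 1%g => //; exact: F_one.
  have <- : f = x ij.2 by apply: d_eq0; apply/eqP; rewrite eq_le fx d_ge0.
  apply: contrapT => noh; apply: (noaa f); apply: filterS FV' => h V'h.
  by rewrite /= dxx leNgt; apply/negP => hf; apply: noh; exists h.
have {}hx i j : 0 < d (h (x i)) (x j) by exact: hx (i, j).
have [eps eps0 epsx] : exists2 eps, 0 < eps & forall i j, eps <= d (h (x i)) (x j).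
  have [eps eps0 epsP] := @fin_lb_gt0 _ _ (fun=> True)
    (fun ij : K * K => d (h (x ij.1)) (x ij.2)) (fun ij _ => hx ij.1 ij.2).
  by exists eps => // i j; exact: epsP (i, j) I.
have [s0 [[_ _ s0b] s00 _]] := Sb_gt0_lt eps0.
have [s [sSb s_gt0]] : exists s, [/\ Sb s, 0 < s & s < Num.min s0 (eps / 2)].
  by apply: Sb_gt0_lt; rewrite lt_min s00 divr_gt0.
rewrite lt_min => /andP[ss0 seps].
have sb : (s%:E < b)%E by exact: ltb_trans s0b.
have w_ex i : exists w, d (x i) w = s.
  have [|||||w [xw _]] := @point_at (x i) (x i) s s => //; last by exists w.
  - by rewrite dxx addr0.
  - by rewrite dxx addr0.
  - by rewrite dxx addr_ge0// ltW.
have [w xw] := choice w_ex.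
pose inner i j := `[< 0 < d (x i) (x j) /\ ((d (x i) (x j))%:E < b)%E >].
pose u (t : K + K * K) := match t with inl i => x i | inr ij => x ij.1 end.
pose v (t : K + K * K) := match t with inl i => w i
  | inr ij => if inner ij.1 ij.2 then x ij.2 else w ij.1 end.
exists (K + K * K)%type, u, v; split=> [[i|[i j]]|g guv] /=.
- by rewrite xw.
- by case: ifPn => [/asboolP|_]//; rewrite xw.
have gx i : d (g (x i)) (x i) <= eps.
  have := d_tri (w i) (g (x i)) (x i); have /= -> := guv (inl i).
  by rewrite (dC (w i)) xw; lra.
have Dge i j : d (x i) (x j) - eps <= d (g (x i)) (x j).
  by have := d_tri (g (x i)) (x i) (x j); have := gx i; rewrite (dC (x i) (g _)); lra.
have Dcase i j : [\/ d (g (x i)) (x j) = d (x i) (x j), x i = x j |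
    (d (x i) (x j))%:E = b].
  case: (ltP 0 (d (x i) (x j))) => xij; last first.
    by constructor 2; apply: d_eq0; apply/eqP; rewrite eq_le xij d_ge0.
  case: (ltP (d (x i) (x j))%:E b) => xijb; last first.
    by constructor 3; apply/eqP; rewrite eq_le xijb d_leb.
  constructor 1; have := guv (inr (i, j)); rewrite /=.
  by rewrite (_ : inner i j)//; apply/asboolP.
have [k [kx kE]] : exists k : G, (forall l, k (x l) = x l) /\
    forall i j, d (k (h (x i))) (h (x j)) = d (g (x i)) (x j).
  apply: amalgam => [i j|i i' j|i i' j|i j j'|i j j'|i j l|i j l|i j l];
    rewrite ?(isom_dist h).
  - exact: dSb.
  - by rewrite -(isom_dist g (x i)); exact: d_tri.
  - rewrite -(isom_dist g (x i)).
    by have := d_tri (x j) (g (x i)) (g (x i')); rewrite (dC (x j)).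
  - exact: d_tri.
  - by have := d_tri (g (x i)) (x j) (x j'); rewrite (dC (x j) (g (x i))).
  - case: (Dcase i j) => [->|xij|xijb].
    + by rewrite -(isom_dist h (x i)); exact: d_tri.
    + rewrite -xij (le_trans (gx i))// (le_trans (epsx i l))// lerDl; exact: d_ge0.
    + apply: (@le_trans _ _ (d (x i) (x j))); last first.
        by rewrite -(isom_dist h (x i)); exact: d_tri.
      by rewrite -lee_fin xijb d_leb.
  - case: (Dcase i j) => [->|xij|xijb].
    + by rewrite -(isom_dist h (x i)); exact: d_tri.
    + by rewrite -xij lerDr d_ge0.
    + have : d (h (x i)) (x l) <= d (x i) (x j) by rewrite -lee_fin xijb d_leb.
      by have := Dge i j; have := epsx j l; lra.
  - case: (Dcase i j) => [->|xij|xijb].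
    + have := d_tri (h (x i)) (h (x j)) (x l).
      by rewrite (dC (h (x j)) (h (x i))) isom_dist.
    + by rewrite -xij lerDr d_ge0.
    + have : d (h (x j)) (x l) <= d (x i) (x j) by rewrite -lee_fin xijb d_leb.
      by have := Dge i j; have := epsx i l; lra.
by apply: (VN h h k g) => // i j; rewrite kE.
Qed.

Section SmallBall.
Variable rho : R.
Hypothesis rho_upper : forall u v, d u v < rho -> ~ upper_nbhd u v.
Hypothesis rho_b : ((rho + rho)%:E <= b)%E.

(* Otherwise conjugating by some [k] fixing [f] with [d (k x_i) x_j] equal to
   [d f x_i + d f x_j] shows that [upper_nbhd f (x l0)] holds. *)
Let increase1 f (K : finType) (x : K -> U) l0 V : (forall l, d f (x l) < rho) -> F V ->
  exists2 h, V h & (forall l, d f (x l) <= d (h f) (x l)) /\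
    d f (x l0) < d (h f) (x l0).
Proof.
move=> xrho FV; apply: contrapT => noh.
have {noh} Vdec h : V h -> (exists l, d (h f) (x l) < d f (x l)) \/
    d (h f) (x l0) <= d f (x l0).
  move=> Vh; case: (leP (d (h f) (x l0)) (d f (x l0))) => [|hl0]; first by right.
  left; apply: contrapT => nol; apply: noh; exists h => //; split=> // l.
  by rewrite leNgt; apply/negP => hl; apply: nol; exists l.
have [k [kf kx]] := free_amalgam x x (fun _ : unit => f) (rho + rho).
apply: (rho_upper (xrho l0)); apply: filterS (filterI FV (F_conj k FV)).
move=> h [/Vdec[[l hl]|//] /Vdec hk].
have {hk} [l' hl'] : exists l', d (h f) (k (x l')) <= d f (x l').
  case: hk => [[l']|]; rewrite !isomM dVl (kf tt) => hk; last by exists l0.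
  by exists l'; exact: ltW.
have lt2 : d (k (x l')) (x l) < d f (x l) + d f (x l').
  by have := d_tri (h f) (k (x l')) (x l); rewrite (dC _ (h f)); lra.
exfalso; have := xrho l; have := xrho l'.
case: (kx l' l) => [[_ kE]|[|kb]].
- by move: lt2; rewrite kE (dC _ f); lra.
- by lra.
- by move: rho_b; rewrite -kb lee_fin; lra.
Qed.

Lemma increase_distances f (K : finType) (x : K -> U) V :
  (forall l, d f (x l) < rho) -> F V ->
  exists2 h, V h & forall l, d f (x l) < d (h f) (x l).
Proof.
move=> xrho FV.
suff [h Vh hx] : exists2 h, V h &
    (forall l, d f (x l) <= d (h f) (x l) < rho) /\
    forall l, l \in enum K -> d f (x l) < d (h f) (x l).
  by exists h => // l; apply: hx.2; rewrite mem_enum.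
elim: (enum K) V FV => [|l0 s IHs] V FV.
  by exists 1%g; [exact: F_one|split=> // l; rewrite isom1 lexx xrho].
have [V1 FV1 V1V] := F_mul FV.
have [h1 Vh1 [h1x h1s]] := IHs _ FV1.
have h1rho l : d (h1 f) (x l) < rho by case/andP: (h1x l).
have [|h2 [Vh2 h2rho] [h2x h2l0]] := @increase1 (h1 f) K x l0
    (V1 `&` [set h : G | forall l, d (h (h1 f)) (x l) < rho]) h1rho.
  apply: filterI => //.
  apply: (@filter_forall _ _ (fun l => [set h : G | d (h (h1 f)) (x l) < rho])) => l.
  exact: F_lt.
exists (h2 * h1)%g; first exact: V1V.
have h21 l : d f (x l) <= d (h1 f) (x l) by case/andP: (h1x l).
split=> l; rewrite isomM.
  by rewrite h2rho andbT (le_trans (h21 l)).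
rewrite inE => /predU1P[->|/h1s]; first exact: le_lt_trans h2l0.
by move/lt_le_trans; apply.
Qed.

End SmallBall.

Lemma increase_near (rho r : R) u (K : finType) (x : K -> U) V :
  (forall u v, d u v < rho -> ~ upper_nbhd u v) -> ((rho + rho)%:E <= b)%E ->
  (forall l, d u (x l) <= r -> lower_nbhd u (x l)) -> F V ->
  exists2 h, V h & forall l, [/\ d u (x l) < rho -> d u (x l) < d (h u) (x l),
    d u (x l) <= r -> d u (x l) <= d (h u) (x l) &
    r < d u (x l) -> r < d (h u) (x l)].
Proof.
move=> rho_upper rho_b xr FV.
have [|h [[Vh h1] h2] hx] := increase_distances rho_upper rho_b
    (fun l : {l | d u (x l) < rho} => valP l) (V := V `&`
    [set h : G | forall l, d u (x l) <= r -> d u (x l) <= d (h u) (x l)] `&`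
    [set h : G | forall l, r < d u (x l) -> r < d (h u) (x l)]).
  apply: filterI; first apply: filterI => //.
    exact: (F_forall_in (P := fun l => d u (x l) <= r)
      (A := fun l => [set h : G | d u (x l) <= d (h u) (x l)])).
  apply: (F_forall_in (P := fun l => r < d u (x l))
    (A := fun l => [set h : G | r < d (h u) (x l)])) => l; exact: F_gt.
exists h => // l; split; [|exact: h1|exact: h2].
by move=> xl; exact: (hx (exist _ l xl)).
Qed.

Lemma upper_nbhd_shrink u v : upper_nbhd u v -> 0 < d u v ->
  ((d u v + d u v)%:E <= b)%E ->
  exists u' v', upper_nbhd u' v' /\ d u' v' < 3 / 4 * d u v.
Proof.
set r := d u v => uvF r0 rb; apply: contrapT => nosmall.
pose rho := 3 / 4 * r.
have rho_upper u' v' : d u' v' < rho -> ~ upper_nbhd u' v'.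
  by move=> uv' F'; apply: nosmall; exists u', v'.
have rho_b : ((rho + rho)%:E <= b)%E by apply: leb_trans rb; rewrite /rho; lra.
have low u' v' : d u' v' <= r -> lower_nbhd u' v'.
  move=> le_r; apply: upper_lower_nbhd uvF.
  by apply: leb_trans rb; rewrite lerD2l.
have [V [K [x [FV _ VN]]]] := double_coset (of_void U) uvF.
have [h1 Vh1 h1x] := increase_near rho_upper rho_b (fun l => low u (x l)) FV.
have [h2 Vh2 h2x] := increase_near rho_upper rho_b (fun l => low v (x l)) FV.
have [k [kx kE]] := free_amalgam (fun _ : unit => h1 u) (fun _ : unit => h2 v) x (r + r).
have : d ((h2^-1 * (k * h1))%g u) v <= r.
  by apply: (VN h1 h2 k) => // i j; rewrite isomM dVl.
rewrite isomM dVl isomM leNgt => /negP; apply.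
case: (kE tt tt) => [[l ->]|[rr|kb]].
- rewrite (dC (x l)).
  have ab : r <= d u (x l) + d v (x l) by rewrite (dC v); exact: d_tri.
  have := d_ge0 (h1 u) (x l); have := d_ge0 (h2 v) (x l).
  move: (h1x l) (h2x l) ab r0; rewrite /rho; clear.
  move: (d u _) (d v _) (d (h1 u) _) (d (h2 v) _) => A B A' B'.
  move=> [a1 a2 a3] [b1 b2 b3] ab r0 B0 A0.
  case: (leP A r) => [Ar|/a3]; last by lra.
  case: (leP B r) => [Br|/b3]; last by lra.
  move: (a2 Ar) (b2 Br) => {}a2 {}b2.
  case: (ltP A (3 / 4 * r)) => [/a1|Ar']; first by lra.
  by case: (ltP B (3 / 4 * r)) => [/b1|Br']; lra.
- by apply: lt_le_trans rr; rewrite ltrDl.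
- by rewrite -lte_fin kb; apply: ltb_trans rb; rewrite ltrDl.
Qed.

Lemma upper_nbhd_small u v e : (forall a, ~ upper_nbhd a a) -> upper_nbhd u v ->
  ((d u v + d u v)%:E <= b)%E -> 0 < e ->
  exists u' v', upper_nbhd u' v' /\ d u' v' < e.
Proof.
move=> noaa uvF uvb e0; apply: contrapT => nosmall.
pose E := [set r | exists u' v', upper_nbhd u' v' /\ d u' v' = r].
have Ee r : E r -> e <= r.
  move=> [u' [v' [F' <-]]]; rewrite leNgt; apply/negP => lt_e.
  by apply: nosmall; exists u', v'.
have E0 : E !=set0 by exists (d u v), u, v.
have infE : has_inf E by split=> //; exists e => r /Ee.
have e_inf : e <= inf E by apply: lb_le_inf => // r /Ee.
have inf3 : 0 < inf E / 3 by rewrite divr_gt0// (lt_le_trans e0).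
have [r [u1 [v1 [uvF1 <-]]] r_inf] := inf_adherent inf3 infE.
have [u2 [v2 [uvF2 uv2b uv2]]] : exists u2 v2, [/\ upper_nbhd u2 v2,
    ((d u2 v2 + d u2 v2)%:E <= b)%E & d u2 v2 <= d u1 v1].
  case: (leP (d u1 v1) (d u v)) => uv1; last by exists u, v; split=> //; exact: ltW.
  exists u1, v1; split=> //; apply: leb_trans uvb; exact: lerD.
have uv2_gt0 : 0 < d u2 v2.
  rewrite lt_def d_ge0 andbT; apply/eqP => /d_eq0 uv20.
  by apply: (noaa u2); move: uvF2; rewrite -uv20.
have [u3 [v3 [uvF3 uv3]]] := upper_nbhd_shrink uvF2 uv2_gt0 uv2b.
have : inf E <= d u3 v3 by apply: ge_inf; [exact: infE.2|exists u3, v3].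
by move: uv3 uv2 r_inf; lra.
Qed.

Lemma partial_distance_nbhd u v : (forall a, ~ upper_nbhd a a) ->
  upper_nbhd u v -> ((d u v + d u v)%:E <= b)%E ->
  forall u' v', 0 < d u' v' -> ((d u' v')%:E < b)%E -> F (distance_preserver d u' v').
Proof.
move=> noaa uvF uvb u' v' uv'0 /ltb_gap[e e0 eb].
have [|u1 [v1 [uvF1]]] := @upper_nbhd_small _ _ (Num.min e (d u' v')) noaa uvF uvb.
  by rewrite lt_min e0.
rewrite lt_min => /andP[uv1e uv1].
have up : upper_nbhd u' v' by apply: upper_nbhd_ge uvF1; exact: ltW.
have low : lower_nbhd u' v'.
  by apply: upper_lower_nbhd uvF1; apply: leb_trans eb; rewrite addrC lerD2l ltW.
by apply: filterS (filterI up low) => h /= [hle hge]; apply/eqP; rewrite eq_le hle.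
Qed.

Section NoUpper.
Hypothesis no_upper : forall u v, ((d u v + d u v)%:E <= b)%E -> ~ upper_nbhd u v.

(* If all of [V] kept [f] on the segment from [z] to its nearest endpoint [y], then,
   conjugating by some [k] fixing [f], [upper_nbhd f z] and [lower_nbhd f y] would
   hold, so that [b / 2 < d f z]; [h2^-1 * k' * h1] then moves [f] off the segment
   when [h1] increases the distances < b / 2 from [f], and [h2], much closer to the
   identity than [h1], those from [z]. *)
Let leave_segment_wlog f z y V : d f y <= d f z -> ((d z y)%:E < b)%E -> F V ->
  exists2 h, V h & d z y < d (h f) z + d (h f) y.
Proof.
move=> yz zyb FV; apply: contrapT => noh.
have {noh} Vseg h : V h -> d (h f) z + d (h f) y <= d z y.
  by move=> Vh; rewrite leNgt; apply/negP => hgt; apply: noh; exists h.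
have zy : d z y = d f z + d f y.
  have := Vseg _ (F_one FV); rewrite isom1 => le_zy.
  by apply/eqP; rewrite eq_le le_zy andbT (dC f z) d_tri.
pose zy' (i : bool) := if i then z else y.
have [k [kf kzy]] := free_amalgam zy' zy' (fun _ : unit => f) (d z y + d z y + 1).
have zy0 := d_ge0 z y.
have far i j : d f (zy' i) + d f (zy' j) <= d z y + d z y ->
    d f (zy' i) + d f (zy' j) <= d (k (zy' i)) (zy' j) \/
    d (k (zy' i)) (zy' j) >= d z y.
  move=> ij; case: (kzy i j) => [[_ ->]|[|kb]]; first by left; rewrite (dC f (zy' i)).
    by left; lra.
  by right; rewrite -lee_fin kb ltW.
have [fz0 fy0] := (d_ge0 f z, d_ge0 f y).
have zy_far : d f z + d f y <= d (k z) y.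
  by case: (far true false); rewrite /=; lra.
have yz_far : d f z + d f y <= d (k y) z.
  by case: (far false true); rewrite /=; lra.
have yy_far : d f y + d f y <= d (k y) y.
  by case: (far false false); rewrite /=; lra.
have seg : F [set h | d (h f) z <= d f z /\ d f y <= d (h f) y].
  apply: filterS (filterI FV (F_conj k FV)) => h [/Vseg h1 /Vseg].
  rewrite !isomM !dVl (kf tt) => h2.
  have := d_tri (h f) (k z) y; have := d_tri (h f) (k y) z.
  have := d_tri (h f) (k y) y; rewrite !(dC (k _) (h f)) /=.
  by move: (d (h f) z) (d (h f) y) (d (h f) (k z)) (d (h f) (k y)) h1 h2 => *; split; lra.
have upz : upper_nbhd f z by apply: filterS seg => h [].
have lowy : lower_nbhd f y by apply: filterS seg => h [].
have [B bB fzB] : exists2 B, b = B%:E & B / 2 < d f z.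
  case: b_bound => [b_oo|[B [_ _ bB]]].
    by case: (no_upper _ upz); rewrite b_oo leey.
  exists B => //; rewrite ltNge; apply/negP => fzB; apply: (no_upper _ upz).
  by rewrite bB lee_fin; lra.
have {}zyB : d z y < B by rewrite -lte_fin -bB.
have rho_upper u v : d u v < B / 2 -> ~ upper_nbhd u v.
  by move=> uv; apply: no_upper; rewrite bB lee_fin; lra.
have rho_b : ((B / 2 + B / 2)%:E <= b)%E by rewrite -splitr bB.
have [V' [K [x [FV' _ V'V]]]] := double_coset (of_void U) FV.
have half_f : F [set h : G | forall l,
    B / 2 <= d f (x l) -> d f z - B / 2 < d (h f) (x l)].
  apply: (F_forall_in (P := fun l => B / 2 <= d f (x l))
    (A := fun l => [set h : G | d f z - B / 2 < d (h f) (x l)])) => l xl.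
  by apply: F_gt; lra.
have beta_f : F [set h : G | forall l, d f y < d y (x l) -> d (h f) y < d y (x l)].
  apply: (F_forall_in (P := fun l => d f y < d y (x l))
    (A := fun l => [set h : G | d (h f) y < d y (x l)])) => l; exact: F_lt.
have [|h1 [[[V'h1 h1z] h1half] h1beta] h1x] := increase_distances rho_upper rho_b
    (fun l : {l | d f (x l) < B / 2} => valP l)
    (V := V' `&` [set h | d (h f) z <= d f z] `&`
    [set h : G | forall l, B / 2 <= d f (x l) -> d f z - B / 2 < d (h f) (x l)] `&`
    [set h : G | forall l, d f y < d y (x l) -> d (h f) y < d y (x l)]).
  by repeat apply: filterI.
pose p := h1 f; have pz : d p z <= d f z by exact: h1z.
have {}h1half l : B / 2 <= d f (x l) -> d f z - B / 2 < d p (x l) by exact: h1half.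
have {}h1beta l : d f y < d y (x l) -> d p y < d y (x l) by exact: h1beta.
have close w : F [set h : G | forall l,
    d p w - d p (x l) < d w (x l) -> d p w - d p (x l) < d (h w) (x l)].
  apply: (F_forall_in (P := fun l => d p w - d p (x l) < d w (x l))
    (A := fun l => [set h : G | d p w - d p (x l) < d (h w) (x l)])) => l.
  exact: F_gt.
have low_y : F [set h : G | forall l, d y (x l) <= d f y -> d y (x l) <= d (h y) (x l)].
  apply: (F_forall_in (P := fun l => d y (x l) <= d f y)
    (A := fun l => [set h : G | d y (x l) <= d (h y) (x l)])) => l xl.
  exact: lower_nbhd_le xl lowy.
have [|h2 [[[V'h2 h2z] h2y] h2low] h2x] := increase_distances rho_upper rho_b
    (fun l : {l | d z (x l) < B / 2} => valP l) (V := V' `&`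
    [set h : G | forall l,
      d p z - d p (x l) < d z (x l) -> d p z - d p (x l) < d (h z) (x l)] `&`
    [set h : G | forall l,
      d p y - d p (x l) < d y (x l) -> d p y - d p (x l) < d (h y) (x l)] `&`
    [set h : G | forall l, d y (x l) <= d f y -> d y (x l) <= d (h y) (x l)]).
  by repeat apply: filterI.
have [k' [k'x k'E]] := free_amalgam (fun _ : unit => p) (fun i => h2 (zy' i)) x
  (d p z + d p y + 1).
have claim_z : d p z < d (k' p) (h2 z).
  case: (k'E tt true) => /= [[l ->]|[|kb]].
  - rewrite -ltrBlDl (dC (x l)).
    case: (ltP (d p z - d p (x l)) (d z (x l))) => [/h2z//|pzx].
    case: (ltP (d z (x l)) (B / 2)) => zx.
      apply: le_lt_trans (h2x (exist _ l zx)).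
      by rewrite lerBlDl (dC z) d_tri.
    exfalso; case: (ltP (d f (x l)) (B / 2)) => fx.
      have : d f (x l) < d p (x l) by exact: (h1x (exist _ l fx)).
      by have := d_tri (x l) f z; rewrite (dC (x l) z); lra.
    by have := h1half l fx; lra.
  - by have := d_ge0 p y; lra.
  - by rewrite -lte_fin kb bB lte_fin; lra.
have claim_y : d p y <= d (k' p) (h2 y).
  case: (k'E tt false) => /= [[l ->]|[|kb]].
  - rewrite -lerBlDl (dC (x l)).
    case: (ltP (d p y - d p (x l)) (d y (x l))) => [/h2y/ltW//|pyx].
    case: (leP (d y (x l)) (d f y)) => yx.
      by apply: le_trans (h2low _ yx); rewrite lerBlDl (dC y) d_tri.
    by have := h1beta l yx; have := d_ge0 p (x l); lra.
  - by have := d_ge0 p z; lra.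
  - by rewrite -lee_fin kb d_leb.
have : V (h2^-1 * (k' * h1))%g.
  by apply: (V'V h1 h2 k') => // i j; rewrite isomM dVl.
move=> /Vseg; rewrite !isomM !dVl -/p.
by have := d_tri p z y; rewrite (dC z p); lra.
Qed.

Lemma leave_segment f z y V : ((d z y)%:E < b)%E -> F V ->
  exists2 h, V h & d z y < d (h f) z + d (h f) y.
Proof.
case: (leP (d f y) (d f z)) => [yz|/ltW yz zyb FV]; first exact: leave_segment_wlog.
have [|h Vh hyz] := leave_segment_wlog yz _ FV; first by rewrite dC.
by exists h => //; rewrite addrC dC.
Qed.

Lemma avoid_segments (K : finType) (x : K -> U) V : F V ->
  exists2 h, V h & forall j m l, ((d (x m) (x l))%:E < b)%E ->
    d (x m) (x l) < d (h (x j)) (x m) + d (h (x j)) (x l).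
Proof.
move=> FV; have [||h Vh hx] := achieve_open (fun t : K * K * K => x t.1.1)
    (C := fun t => [set f | ((d (x t.1.2) (x t.2))%:E < b)%E ->
      d (x t.1.2) (x t.2) < d f (x t.1.2) + d f (x t.2)]) _ _ FV.
- move=> [[j m] l] f /=; case: (ltP (d (x m) (x l))%:E b) => ml; last first.
    by move=> _; apply: filterS filterT => h _.
  move=> /(_ isT) fml; set e := (d f (x m) + d f (x l) - d (x m) (x l)) / 2.
  have e0 : 0 < e by rewrite /e; lra.
  have /F_gt Fm : d f (x m) - e < d f (x m) by lra.
  have /F_gt Fl : d f (x l) - e < d f (x l) by lra.
  by apply: filterS (filterI Fm Fl) => h /= [hm hl] _; move: hm hl; rewrite /e; lra.
- move=> [[j m] l] f V' FV' /=; case: (ltP (d (x m) (x l))%:E b) => ml.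
    by have [h V'h hml] := leave_segment f ml FV'; exists h.
  by exists 1%g; first exact: F_one.
by exists h => // j m l; exact: hx (j, m, l).
Qed.

(* The amalgam of two copies of [h x] over [x] in which the distances are
   [M - psi], where [M] is the distance in the free amalgam and [psi] is a small
   increasing function of [M]: then no triangle inequality is an equality. *)
Lemma generic_position (K : finType) (x : K -> U) V : F V ->
  exists2 h, V h & forall i j l,
    [/\ 0 < d (h (x i)) (x l),
        0 < d (x i) (x j) -> d (h (x i)) (x l) < d (x i) (x j) + d (h (x j)) (x l)
      & d (x i) (x j) < d (h (x i)) (x l) + d (h (x j)) (x l)].
Proof.
move=> /(double_coset x)[V' [K' [y [FV' xy V'V]]]].
suff [h [h' [k [Vh Vh' ky hP]]]] : exists h h' k : G, [/\ V' h, V' h',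
    forall l, k (y l) = y l & forall i j l,
    [/\ 0 < d (k (h (y i))) (h' (y l)),
        0 < d (y i) (y j) ->
          d (k (h (y i))) (h' (y l)) < d (y i) (y j) + d (k (h (y j))) (h' (y l))
      & d (y i) (y j) < d (k (h (y i))) (h' (y l)) + d (k (h (y j))) (h' (y l))]].
  exists (h'^-1 * (k * h))%g; first by apply: (V'V h h' k) => // i j; rewrite isomM dVl.
  move=> i j l; have [[[i' <-] [j' <-]] [l' <-]] := (xy i, xy j, xy l).
  by rewrite !isomM !dVl.
have [h Vh h_avoid] := avoid_segments y FV'.
have h_gt0 i l : 0 < d (h (y i)) (y l).
  by have := h_avoid i l l; rewrite dxx => /(_ b_gt0); lra.
pose e (t : K' + K') := match t with inl l => y l | inr i => h (y i) end.
have [B Bub] := fin_ub (fun st => d (e st.1) (e st.2)).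
have [c [cSb c0 Bc _]] := Sb_cap B.
have dc s t : d (e s) (e t) <= c by apply: Bc; [exact: d_leb|exact: Bub (s, t)].
have [M' M'P] := choice (fun ij : K' * K' =>
  fin_min (fun l => d (h (y ij.1)) (y l) + d (y l) (h (y ij.2))) c).
pose M i j := M' (i, j).
have Mc i j : M i j <= c by have [] := M'P (i, j).
have Mle i j l : M i j <= d (h (y i)) (y l) + d (h (y j)) (y l).
  by have [_ /(_ l)] := M'P (i, j); rewrite (dC (y l)).
have Mcase i j : M i j = c \/ exists l, M i j = d (h (y i)) (y l) + d (h (y j)) (y l).
  have [_ _ /=] := M'P (i, j); case=> [|[l]]; first by left.
  by right; exists l; rewrite (dC (h (y j))).
have MC i j : M i j = M j i.
  apply/eqP; rewrite eq_le; apply/andP; split.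
    by case: (Mcase j i) => [->//|[l ->]]; rewrite addrC.
  by case: (Mcase i j) => [->//|[l ->]]; rewrite addrC.
have M_lip i i' j : M i j <= d (y i) (y i') + M i' j.
  case: (Mcase i' j) => [->|[l ->]]; first by rewrite (le_trans (Mc _ _))// lerDr d_ge0.
  by rewrite (le_trans (Mle _ _ l))// addrA lerD2r -(isom_dist h (y i)) d_tri.
have M_gt i j l : d (h (y i)) (y l) < M i j + d (h (y j)) (y l).
  case: (Mcase i j) => [->|[m ->]].
    by have := dc (inr i) (inl l); have := h_gt0 j l; rewrite /=; lra.
  have := d_tri (y m) (h (y i)) (y l).
  have := d_tri (h (y j)) (y m) (y l); rewrite (dC (y m) (h _)).
  have := h_gt0 i m; have := h_avoid j m l.
  case: (ltP (d (y m) (y l))%:E b) => [_ /(_ isT)|ml _]; first by lra.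
  have : d (h (y i)) (y l) <= d (y m) (y l).
    by rewrite -lee_fin; apply: le_trans ml; exact: d_leb.
  by lra.
have M_gt0 i j : 0 < M i j.
  by have := M_gt i j i; have := M_gt j i i; rewrite (MC j i); lra.
have MM_gt i i' j : d (y i) (y i') < M i j + M i' j.
  have dii' : d (y i) (y i') <= c by exact: dc (inl i) (inl i').
  case: (Mcase i j) => [->|[m ->]]; first by have := M_gt0 i' j; lra.
  case: (Mcase i' j) => [->|[l ->]].
    by have := h_gt0 i m; have := h_gt0 j m; lra.
  have := d_tri (y m) (h (y i)) (h (y i')); rewrite isom_dist.
  have := d_tri (y l) (y m) (h (y i')); rewrite (dC (y l) (h _)).
  have := h_avoid j m l; have := h_gt0 i m; have := h_gt0 i' l.
  case: (ltP (d (y m) (y l))%:E b) => [_ _ _ /(_ isT)|ml h1 h2 _]; first by lra.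
  have : d (y i) (y i') <= d (y m) (y l).
    by rewrite -lee_fin; apply: le_trans ml; exact: d_leb.
  have := d_tri (h (y j)) (y m) (y l); rewrite (dC (y m) (h _)); lra.
have [k1 k10 k1P] := @fin_lb_gt0 _ _ (fun=> True) (fun t : K' * K' * K' =>
  M t.1.1 t.1.2 + d (h (y t.1.2)) (y t.2) - d (h (y t.1.1)) (y t.2))
  (fun t _ => ltac:(by rewrite subr_gt0; exact: M_gt)).
have [k2 k20 k2P] := @fin_lb_gt0 _ _ (fun=> True) (fun t : K' * K' * K' =>
  M t.1.1 t.2 + M t.1.2 t.2 - d (y t.1.1) (y t.1.2))
  (fun t _ => ltac:(by rewrite subr_gt0; exact: MM_gt)).
have [k3 k30 k3P] := @fin_lb_gt0 _ _ (fun ij : K' * K' => 0 < d (y ij.1) (y ij.2)) 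
  (fun ij => d (y ij.1) (y ij.2)) (fun ij H => H).
have [k4 k40 k4P] := @fin_lb_gt0 _ _ (fun=> True) (fun ij : K' * K' =>
  M ij.1 ij.2) (fun ij _ => M_gt0 _ _).
have [kappa kappa0 [kk1 kk2 kk3 kk4]] : exists2 kappa, 0 < kappa &
    [/\ kappa <= k1, kappa + kappa <= k2, kappa <= k3 & kappa <= k4].
  exists (Num.min (Num.min k1 (k2 / 2)) (Num.min k3 k4)).
    by rewrite !lt_min k10 k30 k40 divr_gt0.
  split; rewrite ?ge_min ?lexx ?orbT//.
  rewrite [leRHS]splitr; apply: lerD; by rewrite !ge_min lexx !orbT.
pose n := #|{: K' * K'}|.
have [s [[Ss _ _] s0 sk]] : exists s, [/\ Sb s, 0 < s & s < kappa / n.+1%:R].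
  by apply: Sb_gt0_lt; rewrite divr_gt0.
pose rank i j := #|[pred t : K' * K' | M t.1 t.2 < M i j]|.
have rank_lt i j i' j' : M i j < M i' j' -> (rank i j < rank i' j')%N.
  move=> MM; apply: proper_card; apply/properP; split.
    by apply/fintype.subsetP => t; rewrite !inE => /lt_trans; apply.
  by exists (i, j); rewrite !inE //= ltxx.
pose psi i j := s *+ (rank i j).+1.
have psi_gt0 i j : 0 < psi i j by rewrite pmulrn_lgt0.
have psi_lt i j : psi i j < kappa.
  apply: le_lt_trans (_ : s *+ n.+1 < _).
    by rewrite ler_pMn2l// ltnS max_card.
  by rewrite -mulr_natr -ltr_pdivlMr.
have psi_mono i j i' j' : M i j < M i' j' -> psi i j < psi i' j'.
  by move=> /rank_lt MM; rewrite ltr_pMn2l// ltnS.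
have psi_eq i j i' j' : M i j = M i' j' -> psi i j = psi i' j'.
  by move=> MM; rewrite /psi /rank MM.
have psi_S i j : S (psi i j).
  by rewrite /psi; elim: (rank i j).+1 => [|m IHm]; [exact: S0|rewrite mulrS; exact: SD].
pose D i j := M i j - psi i j.
have D_gt0 i j : 0 < D i j.
  by have := k4P (i, j) I; have := psi_lt i j; rewrite /D /=; lra.
have DSb i j : Sb (D i j).
  have : Sb (M i j).
    case: (Mcase i j) => [->//|[m Mm]]; rewrite Mm.
    apply: SbD; [exact: dSb|exact: dSb|].
    by rewrite -Mm; apply: leb_trans (Mc i j) _; have [] := cSb.
  move=> [SM _ Mb]; split; [exact: SB|exact: ltW|].
  by apply: leb_trans Mb; rewrite /D gerBl ltW.
have DC i j : D i j = D j i by rewrite /D (MC i j) (psi_eq _ _ _ _ (MC i j)).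
have D_lip_lt i i' j : 0 < d (y i) (y i') -> D i j < d (y i) (y i') + D i' j.
  move=> /(k3P (i, i')) /= dii'; have := M_lip i i' j.
  have := psi_lt i' j; have := psi_gt0 i j; rewrite /D.
  by case: (leP (M i j) (M i' j)) => [|/psi_mono]; lra.
have D_lip i i' j : D i j <= d (y i) (y i') + D i' j.
  case: (ltP 0 (d (y i) (y i'))) => [/D_lip_lt/ltW//|dii'].
  have {}dii' : d (y i) (y i') = 0 by apply/eqP; rewrite eq_le dii' d_ge0.
  have Mii' : M i j = M i' j.
    by have := M_lip i i' j; have := M_lip i' i j; rewrite (dC (y i')) dii'; lra.
  by rewrite /D Mii' (psi_eq _ _ _ _ Mii') dii' add0r.
have DD_gt i i' j : d (y i) (y i') < D i j + D i' j.
  have /= := k2P (i, i', j) I; have := psi_lt i j; have := psi_lt i' j.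
  by rewrite /D; lra.
have D_gt i j l : d (h (y i)) (y l) < D i j + d (h (y j)) (y l).
  by have /= := k1P (i, j, l) I; have := psi_lt i j; rewrite /D; lra.
have [k [ky kE]] : exists k : G, (forall l, k (y l) = y l) /\
    forall i j, d (k (h (y i))) (h (y j)) = D i j.
  apply: amalgam => [i j|i i' j|i i' j|i j j'|i j j'|i j l|i j l|i j l];
    rewrite ?(isom_dist h).
  - exact: DSb.
  - exact: D_lip.
  - exact: ltW.
  - by rewrite (DC i j) (DC i j') addrC (dC (y j')); exact: D_lip.
  - by rewrite (DC i j) (DC i j'); exact: ltW.
  - by rewrite (dC (y l)) (le_trans _ (Mle i j l))// /D gerBl ltW.
  - exact: ltW.
  - by rewrite DC; exact: ltW.
by exists h, h, k; split=> // i j l; rewrite !kE; split=> //; exact: D_lip_lt.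
Qed.

Lemma sub_metric N : F N -> exists (K : finType) (x : K -> U) (e : R), 0 < e /\
  forall g : G, (forall l, d (g (x l)) (x l) <= e) -> N g.
Proof.
move=> /(double_coset (of_void U))[V [K [x [FV _ VN]]]].
have [h Vh hx] := generic_position x FV.
have [k1 k10 k1P] := @fin_lb_gt0 _ _ (fun t : K * K * K => 0 < d (x t.1.1) (x t.1.2))
  (fun t => d (x t.1.1) (x t.1.2) + d (h (x t.1.2)) (x t.2) - d (h (x t.1.1)) (x t.2))
  (fun t xt => ltac:(by rewrite subr_gt0; have [_ H _] := hx t.1.1 t.1.2 t.2; exact: H)).
have [k2 k20 k2P] := @fin_lb_gt0 _ _ (fun=> True) (fun t : K * K * K =>
  d (h (x t.1.1)) (x t.2) + d (h (x t.1.2)) (x t.2) - d (x t.1.1) (x t.1.2))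
  (fun t _ => ltac:(by rewrite subr_gt0; have [_ _ H] := hx t.1.1 t.1.2 t.2; exact: H)).
have [e [e0 ek1 ek2]] : exists e, [/\ 0 < e, e <= k1 & e <= k2].
  by exists (Num.min k1 k2); rewrite lt_min k10 k20 !ge_min !lexx orbT.
exists K, x, e; split=> // g gx.
have Dle i j : d (g (x i)) (x j) <= d (x i) (x j) + e.
  by have := d_tri (x i) (g (x i)) (x j); have := gx i; lra.
have Dge i j : d (x i) (x j) - e <= d (g (x i)) (x j).
  by have := d_tri (g (x i)) (x i) (x j); have := gx i; rewrite (dC (x i) (g (x i))); lra.
have D_gt i j l : d (h (x i)) (x l) <= d (g (x i)) (x j) + d (h (x j)) (x l).
  case: (ltP 0 (d (x i) (x j))) => xij.
    by have /= := k1P (i, j, l) xij; have := Dge i j; lra.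
  rewrite (_ : x i = x j) ?lerDr ?d_ge0//.
  by apply: d_eq0; apply/eqP; rewrite eq_le xij d_ge0.
have [k [kx kE]] : exists k : G, (forall l, k (x l) = x l) /\
    forall i j, d (k (h (x i))) (h (x j)) = d (g (x i)) (x j).
  apply: amalgam => [i j|i i' j|i i' j|i j j'|i j j'|i j l|i j l|i j l];
    rewrite ?(isom_dist h).
  - exact: dSb.
  - by rewrite -(isom_dist g (x i)); exact: d_tri.
  - rewrite -(isom_dist g (x i)).
    by have := d_tri (x j) (g (x i)) (g (x i')); rewrite (dC (x j)).
  - exact: d_tri.
  - by have := d_tri (g (x i)) (x j) (x j'); rewrite (dC (x j) (g (x i))).
  - rewrite (dC (x l)); have /= := k2P (i, j, l) I; have := Dle i j; lra.
  - exact: D_gt.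
  - case: (ltP 0 (d (x j) (x i))) => xij.
      have /= := k1P (j, i, l) xij; have := Dge i j; rewrite (dC (x j) (x i)); lra.
    rewrite (_ : x j = x i) ?lerDr ?d_ge0//.
    by apply: d_eq0; apply/eqP; rewrite eq_le xij d_ge0.
by apply: (VN h h k g) => // i j; rewrite kE.
Qed.

End NoUpper.
End MetricFilter.
End GroupFilter.

(** * The four filters *)

Definition stabilizer_filter : set_system G :=
  smallest (@Filter G) [set pointwise_stabilizer d A | A in [set A | finite_set A]].

Definition displacement_filter : set_system G :=
  smallest (@Filter G) [set N | exists u e, [/\ S e, 0 < e, (e%:E <= b)%E
                                             & N = displacement_ball d u e]].

Definition preserver_filter : set_system G :=
  smallest (@Filter G) [set distance_preserver d uv.1 uv.2 | uv in
    [set uv | 0 < d uv.1 uv.2 /\ ((d uv.1 uv.2)%:E < b)%E]].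

Lemma stabilizer_filterP N : stabilizer_filter N <->
  exists (K : finType) (x : K -> U), forall g : G, (forall l, g (x l) = x l) -> N g.
Proof.
split=> [/smallest_filter_family[K [A [Afin AN]]]|[K [x xN]]]; last first.
  apply/smallest_filter_family; exists unit, (fun=> range x); split=> [_|g gx].
    exact: finite_image finite_finset.
  by apply: xN => l; apply: (gx tt); exists l.
have /choice[s sA] l : exists s : seq {classic U}, A l = [set` s].
  by apply/finite_seqP; exact: Afin.
exists {l : K & 'I_(size (s l))}, (fun li => tnth (in_tuple (s (tag li))) (tagged li)).
move=> g gx; apply: AN => l u; rewrite sA /= => /(tnthP (in_tuple (s l)))[i ->].
exact: (gx (Tagged _ i)).
Qed.

Lemma displacement_filterP N : displacement_filter N <->
  exists (K : finType) (x : K -> U) (e : R), 0 < e /\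
    forall g : G, (forall l, d (g (x l)) (x l) <= e) -> N g.
Proof.
have -> : displacement_filter = smallest (@Filter G)
    [set displacement_ball d ue.1 ue.2 | ue in [set ue | [/\ S ue.2, 0 < ue.2 & (ue.2%:E <= b)%E]]].
  congr smallest; apply/seteqP; split=> [_ [u [e [Se e0 eb ->]]]|_ [[u e] /= [Se e0 eb] <-]].
    by exists (u, e).
  by exists u, e.
split=> [/smallest_filter_family[K [ue [ueP ueN]]]|[K [x [e [e0 xN]]]]].
  have [|e e0 eue] := @fin_lb_gt0 _ _ (fun=> True) (fun l => (ue l).2).
    by move=> l _; have [] := ueP l.
  exists K, (fun l => (ue l).1), e; split=> // g gx; apply: ueN => l.
  by apply: le_trans (gx l) _; exact: eue.
have [s [[Ss _ sb] s0 se]] := Sb_gt0_lt e0.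
apply/smallest_filter_family; exists K, (fun l => (x l, s)); split=> // g gx.
by apply: xN => l; apply: le_trans (gx l) _; exact: ltW.
Qed.

Lemma preserver_filterP N : preserver_filter N <->
  exists (K : finType) (u v : K -> U),
    (forall l, 0 < d (u l) (v l) /\ ((d (u l) (v l))%:E < b)%E) /\
    forall g : G, (forall l, d (g (u l)) (v l) = d (u l) (v l)) -> N g.
Proof.
split=> [/smallest_filter_family[K [uv [uvP uvN]]]|[K [u [v [uvP uvN]]]]].
  by exists K, (fun l => (uv l).1), (fun l => (uv l).2).
by apply/smallest_filter_family; exists K, (fun l => (u l, v l)).
Qed.

Lemma stabilizer_group_filter : group_filter stabilizer_filter.
Proof.
split; first exact: smallest_filter_filter.
- by move=> N /stabilizer_filterP[K [x xN]]; exact: xN.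
- move=> N /stabilizer_filterP[K [x xN]].
  exists [set g : G | forall l, g (x l) = x l].
    by apply/stabilizer_filterP; exists K, x.
  by move=> g h gx hx; apply: xN => l; rewrite isomM hx gx.
- move=> N /stabilizer_filterP[K [x xN]]; apply/stabilizer_filterP.
  by exists K, x => g gx; apply: xN => l; rewrite -[in LHS]gx isomK.
- move=> k N /stabilizer_filterP[K [x xN]]; apply/stabilizer_filterP.
  by exists K, (fun l => k (x l)) => g gx; apply: xN => l; rewrite !isomM gx isomK.
Qed.

Lemma displacement_group_filter : group_filter displacement_filter.
Proof.
split; first exact: smallest_filter_filter.
- move=> N /displacement_filterP[K [x [e [e0 xN]]]]; apply: xN => l.
  by rewrite isom1 dxx ltW.
- move=> N /displacement_filterP[K [x [e [e0 xN]]]].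
  exists [set g : G | forall l, d (g (x l)) (x l) <= e / 2].
    by apply/displacement_filterP; exists K, x, (e / 2); rewrite divr_gt0.
  move=> g h gx hx; apply: xN => l; rewrite isomM.
  have := d_tri (g (x l)) (g (h (x l))) (x l); rewrite isom_dist.
  by have := gx l; have := hx l; lra.
- move=> N /displacement_filterP[K [x [e [e0 xN]]]]; apply/displacement_filterP.
  by exists K, x, e; split=> // g gx; apply: xN => l; rewrite dVl dC.
- move=> k N /displacement_filterP[K [x [e [e0 xN]]]]; apply/displacement_filterP.
  exists K, (fun l => k (x l)), e; split=> // g gx; apply: xN => l.
  by rewrite !isomM dVl.
Qed.

Lemma preserver_group_filter : group_filter preserver_filter.
Proof.
split; first exact: smallest_filter_filter.
- by move=> N /preserver_filterP[K [u [v [_ uvN]]]]; apply: uvN.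
- move=> N /preserver_filterP[K [u [v [uvP uvN]]]].
  have /choice[w wP] l : exists w : U * U,
      [/\ d (u l) w.1 + d w.1 (v l) = d (u l) (v l),
      0 < d (u l) w.1 < d (u l) (v l), d (u l) w.2 = d (u l) (v l) + d w.2 (v l),
      0 < d w.2 (v l) & ((d (u l) w.2)%:E < b)%E].
    have [uv0 /ltb_gap[e e0 eb]] := uvP l.
    have [|s [sSb s0]] := @Sb_gt0_lt (Num.min e (d (u l) (v l))).
      by rewrite lt_min e0.
    rewrite lt_min => /andP[se suv].
    have uvsb : ((d (u l) (v l) + s)%:E < b)%E by apply: ltb_trans eb; rewrite ltrD2l.
    have [w1 [uw1 vw1]] : exists w, d (u l) w = s /\ d (v l) w = d (u l) (v l) - s.
      apply: point_at => //; [|lra..].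
      by apply: SbB => //; [exact: dSb|exact: ltW].
    have [w2 [uw2 vw2]] : exists w, d (u l) w = d (u l) (v l) + s /\ d (v l) w = s.
      apply: point_at => //; [|lra..].
      by apply: SbD => //; [exact: dSb|exact: ltW].
    exists (w1, w2) => /=; rewrite uw1 uw2 (dC w1) (dC w2) vw1 vw2.
    by split=> //; [lra|rewrite s0].
  pose u' (t : K + K + (K + K)) := match t with inl (inl l) => u l | inl (inr l) => u l
    | inr (inl l) => (w l).1 | inr (inr l) => (w l).2 end.
  pose v' (t : K + K + (K + K)) := match t with inl (inl l) => (w l).1
    | inl (inr l) => (w l).2 | inr (inl l) => v l | inr (inr l) => v l end.
  exists [set g : G | forall t, d (g (u' t)) (v' t) = d (u' t) (v' t)].
    apply/preserver_filterP; exists (K + K + (K + K))%type, u', v'; split=> //.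
    move=> t; suff [t0 [l tl]] : 0 < d (u' t) (v' t) /\
        exists l, d (u' t) (v' t) <= d (u l) (v l) \/ d (u' t) (v' t) <= d (u l) (w l).2.
      split=> //; have [_ uvb] := uvP l; have [_ _ _ _ uwb] := wP l.
      by case: tl => tl; exact: leb_ltb_trans tl _.
    by case: t => [[]|[]] l; rewrite /u' /v'; have [w1 /andP[w2 w3] w4 w5 w6] := wP l;
      (split; [lra|exists l; lra]).
  move=> g h gw hw; apply: uvN => l; rewrite isomM -dVr.
  have hw1 : d (h (u l)) (w l).1 = d (u l) (w l).1 by exact: hw (inl (inl l)).
  have hw2 : d (h (u l)) (w l).2 = d (u l) (w l).2 by exact: hw (inl (inr l)).
  have gw1 : d (w l).1 (g^-1%g (v l)) = d (w l).1 (v l).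
    by rewrite dVr; exact: gw (inr (inl l)).
  have gw2 : d (w l).2 (g^-1%g (v l)) = d (w l).2 (v l).
    by rewrite dVr; exact: gw (inr (inr l)).
  have [w1 _ w4 _ _] := wP l.
  have := d_tri (w l).1 (h (u l)) (g^-1%g (v l)).
  have := d_tri (g^-1%g (v l)) (h (u l)) (w l).2.
  rewrite (dC (g^-1%g (v l)) (w l).2) hw1 hw2 gw1 gw2 => dge dle.
  by apply/eqP; rewrite eq_le; apply/andP; split; lra.
- move=> N /preserver_filterP[K [u [v [uvP uvN]]]]; apply/preserver_filterP.
  exists K, v, u; split=> [l|g gvu]; first by rewrite dC.
  by apply: uvN => l; rewrite dVl dC gvu dC.
- move=> k N /preserver_filterP[K [u [v [uvP uvN]]]]; apply/preserver_filterP.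
  exists K, (fun l => k (u l)), (fun l => k (v l)); split=> [l|g gk].
    by rewrite isom_dist.
  by apply: uvN => l; rewrite !isomM dVl gk isom_dist.
Qed.

Lemma setT_group_filter : group_filter [set setT : set G].
Proof.
split.
- split=> // [A B -> ->|A B AB AT]; first by rewrite /= setIT.
  by apply/seteqP; split=> // x _; apply: AB; rewrite AT.
- by move=> N ->.
- by move=> N ->; exists setT.
- by move=> N ->; apply/seteqP; split.
- by move=> k N ->; apply/seteqP; split.
Qed.

Lemma group_filter_classification (F : set_system G) :
  group_filter F -> F `<=` stabilizer_filter ->
  [\/ F = stabilizer_filter, F = preserver_filter,
      F = displacement_filter | F = [set setT]].
Proof.
move=> gF Fst.
have F_st N : F N -> exists (K : finType) (x : K -> U),
  forall g : G, (forall l, g (x l) = x l) -> N g by move=> /Fst/stabilizer_filterP.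
have [FF _ _ _ _] := gF.
have [F_ball|] := pselect (forall u (e : R), 0 < e -> F (displacement_ball d u e));
    last first.
  move=> /existsNP[u /existsNP[e /not_implyP[e0 nF]]].
  constructor 4; apply/seteqP; split=> N; last by move=> ->; exact: filterT.
  move=> FN; apply/seteqP; split=> // g _.
  exact: (nonmetric_trivial gF F_st e0 nF g FN).
have [[a Fa]|noaa] := pselect (exists a, upper_nbhd F a a).
  constructor 1; apply/seteqP; split=> // N /stabilizer_filterP[K [x xN]].
  apply: filterS xN _.
  apply: (@filter_forall _ _ (fun l => [set g : G | g (x l) = x l])) => l.
  have := upper_nbhd_eq gF _ Fa; rewrite /upper_nbhd => /(_ (x l) (x l)).
  rewrite !dxx => /(_ erefl); apply: filterS => g gx.
  by apply: d_eq0; apply/eqP; rewrite eq_le gx d_ge0.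
have {}noaa a : ~ upper_nbhd F a a by move=> Fa; apply: noaa; exists a.
have [[u [v [Fuv uvb]]]|no_up] := pselect (exists u v, upper_nbhd F u v /\
    ((d u v + d u v)%:E <= b)%E).
  constructor 2; apply/seteqP; split=> N.
    by move=> FN; apply/preserver_filterP; exact: (sub_partial_distance gF F_st F_ball).
  move=> /preserver_filterP[K [u' [v' [uvP uvN]]]]; apply: filterS uvN _.
  apply: (@filter_forall _ _ (fun l => distance_preserver d (u' l) (v' l))) => l.
  have [uv0 uv1] := uvP l.
  exact: (partial_distance_nbhd gF F_st F_ball noaa Fuv).
constructor 3; apply/seteqP; split=> N.
  move=> FN; apply/displacement_filterP.
  apply: (sub_metric gF F_st F_ball) => // u v uvb Fuv.
  by apply: no_up; exists u, v.
move=> /displacement_filterP[K [x [e [e0 xN]]]]; apply: filterS xN _.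
apply: (@filter_forall _ _ (fun l => displacement_ball d (x l) e)) => l.
exact: F_ball.
Qed.

Lemma urysohn_point : exists u : U, True.
Proof.
have [w _] := @pseudometric_embed unit (fun _ _ => 0) (fun _ _ => Sb0)
  (fun=> erefl) (fun _ _ => erefl) (fun _ _ _ => ler_wpDr (lexx 0) (lexx 0)).
by exists (w tt).
Qed.

Definition all_preserver_filter : set_system G :=
  smallest (@Filter G) [set W | exists u v, 0 < d u v /\ W = distance_preserver d u v].

Lemma all_preserver_filterE : all_preserver_filter = smallest (@Filter G)
  [set distance_preserver d uv.1 uv.2 | uv in [set uv | 0 < d uv.1 uv.2]].
Proof.
congr smallest; apply/seteqP; split=> [_ [u [v [uv ->]]]|_ [[u v] /= uv <-]].
  by exists (u, v).
by exists u, v.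
Qed.

Lemma stabilizer_not_preserver u :
  ~ all_preserver_filter (pointwise_stabilizer d [set u]).
Proof.
rewrite all_preserver_filterE => /smallest_filter_family[K [uv [uv0 uvN]]].
pose x (t : option (K + K)) := match t with None => u
  | Some (inl l) => (uv l).1 | Some (inr l) => (uv l).2 end.
have [m m0 mP] := @fin_lb_gt0 _ _ (fun st => 0 < d (x st.1) (x st.2))
  (fun st => d (x st.1) (x st.2)) (fun st H => H).
have [s [sSb s0 sm]] := Sb_gt0_lt m0.
pose D i j := if 0 < d (x i) (x j) then d (x i) (x j) else s.
have D_ge0 i j : 0 <= D i j by rewrite /D; case: ifP => _; [exact: d_ge0|exact: ltW].
have Dcase i j : 0 < d (x i) (x j) /\ D i j = d (x i) (x j) /\ s <= d (x i) (x j) \/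
    x i = x j /\ D i j = s.
  rewrite /D; case: ltP => xij; [left|right].
    by do 2!split=> //; apply: le_trans (ltW sm) _; exact: mP (i, j) xij.
  by split=> //; apply: d_eq0; apply/eqP; rewrite eq_le xij d_ge0.
have DC i j : D i j = D j i by rewrite /D dC.
have D1 i i' j : D i j <= d (x i) (x i') + D i' j.
  case: (Dcase i j) => [[xij [-> sij]]|[xij ->]].
    case: (Dcase i' j) => [[_ [-> _]]|[<- ->]]; first exact: d_tri.
    by rewrite lerDl ltW.
  case: (Dcase i' j) => [[_ [-> si'j]]|[_ ->]]; last by rewrite lerDr d_ge0.
  by rewrite (le_trans si'j)// lerDr d_ge0.
have D2 i i' j : d (x i) (x i') <= D i j + D i' j.
  case: (Dcase i j) => [[_ [-> _]]|[-> ->]].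
    case: (Dcase i' j) => [[_ [-> _]]|[-> ->]]; first by rewrite (dC (x i')) d_tri.
    by rewrite lerDl ltW.
  case: (Dcase i' j) => [[_ [-> _]]|[-> ->]]; first by rewrite (dC (x i')) lerDr ltW.
  by rewrite dxx addr_ge0// ltW.
have [g [_ gx]] : exists g : G, (forall l, g (of_void U l) = of_void U l) /\
    forall i j, d (g (x i)) (x j) = D i j.
  apply: amalgam => [i j|i i' j|i i' j|i j j'|i j j'|i j []|i j []|i j []] //.
  - by rewrite /D; case: ifP => _; [exact: dSb|].
  - by rewrite (DC i j) (DC i j') addrC (dC (x j')).
  - by rewrite (DC i j) (DC i j').
have := uvN g; rewrite /pointwise_stabilizer /= => gw.
have := gx None None; rewrite /= gw // => [|l].
  by rewrite /D /= dxx ltxx => s00; move: s0; rewrite -s00 ltxx.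
by have := gx (Some (inl l)) (Some (inr l)); rewrite /D /= uv0.
Qed.

Lemma Sb_lt_b : exists s, [/\ Sb s, 0 < s & (s%:E < b)%E].
Proof.
have [s0 [[_ _ s0b] s00 _]] := Sb_gt0_lt (ltr01 : (0 : R) < 1).
have [s [sSb s_gt0 ss0]] := Sb_gt0_lt s00.
by exists s; split=> //; exact: ltb_trans s0b.
Qed.

Lemma point_at_dist u s : Sb s -> exists v, d u v = s.
Proof.
move=> sSb; have [_ s0 _] := sSb.
have [|||||v [uv _]] := @point_at u u s s => //; last by exists v.
- by rewrite dxx addr0.
- by rewrite dxx addr0.
- by rewrite dxx addr_ge0.
Qed.

Lemma preserver_not_displacement : ~ preserver_filter `<=` displacement_filter.
Proof.
move=> sub; have [u _] := urysohn_point.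
have [r [rSb r0 rb]] := Sb_lt_b; have [v uv] := point_at_dist u rSb.
have /displacement_filterP[K [x [e [e0 xN]]]] :
    displacement_filter (distance_preserver d u v).
  apply: sub; apply: sub_gen_smallest; exists (u, v) => //=; by rewrite uv.
have [e1 e10 e1b] := ltb_gap rb.
have [s [sSb s0]] : exists s, [/\ Sb s, 0 < s & s < Num.min e e1].
  by apply: Sb_gt0_lt; rewrite lt_min e0.
rewrite lt_min => /andP[se se1].
have rsb : ((r + s)%:E <= b)%E by apply: leb_trans e1b; rewrite lerD2l ltW.
pose y (t : K + bool) := match t with inl l => x l | inr i => if i then u else v end.
have [B Bub] := fin_ub (fun st => d (y st.1) (y st.2)).
have [c [cSb c0 Bc _]] := Sb_cap (Num.max B (r + s)).
have yc i j : d (y i) (y j) <= c.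
  by apply: Bc; [exact: d_leb|rewrite le_max (Bub (i, j))].
have rsc : r + s <= c by apply: Bc => //; rewrite le_max lexx orbT.
pose D i j := Num.min c (d (y i) (y j) + s).
have Dcase i j : D i j = c \/ D i j = d (y i) (y j) + s /\ d (y i) (y j) + s <= c.
  rewrite /D; case: (leP c (d (y i) (y j) + s)) => ij; [left|right].
    by [].
  by split=> //; exact: ltW.
have Dc i j : D i j <= c by rewrite /D ge_min lexx.
have Dle i j : D i j <= d (y i) (y j) + s by rewrite /D ge_min lexx orbT.
have DC i j : D i j = D j i by rewrite /D dC.
have D1 i i' j : D i j <= d (y i) (y i') + D i' j.
  case: (Dcase i' j) => [->|[-> _]]; first by rewrite (le_trans (Dc _ _))// lerDr d_ge0.
  by rewrite (le_trans (Dle _ _))// addrA lerD2r d_tri.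
have D0 i j : 0 <= D i j.
  by case: (Dcase i j) => [->|[-> _]]; [exact: ltW|rewrite addr_ge0 ?d_ge0 ?ltW].
have D2 i i' j : d (y i) (y i') <= D i j + D i' j.
  case: (Dcase i j) => [->|[-> _]]; first by rewrite (le_trans (yc _ _))// lerDl.
  case: (Dcase i' j) => [->|[-> _]].
    by rewrite (le_trans (yc _ _))// lerDr addr_ge0 ?d_ge0 ?ltW.
  by have := d_tri (y j) (y i) (y i'); rewrite (dC (y j)); lra.
have [g [_ gy]] : exists g : G, (forall l, g (of_void U l) = of_void U l) /\
    forall i j, d (g (y i)) (y j) = D i j.
  apply: amalgam => [i j|i i' j|i i' j|i j j'|i j j'|i j []|i j []|i j []] //.
  - case: (Dcase i j) => [->//|[-> ijc]]; apply: SbD => //; first exact: dSb.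
    by apply: leb_trans ijc _; have [] := cSb.
  - by rewrite (DC i j) (DC i j') addrC (dC (y j')).
  - by rewrite (DC i j) (DC i j').
have : distance_preserver d u v g.
  apply: xN => l; have := gy (inl l) (inl l) => /= ->.
  by rewrite (le_trans (Dle _ _))// /= dxx add0r ltW.
rewrite /distance_preserver /=; have := gy (inr true) (inr false) => /= ->.
by rewrite /D /= uv min_r//; lra.
Qed.

Lemma displacement_not_trivial : ~ displacement_filter `<=` [set setT].
Proof.
move=> sub; have [u _] := urysohn_point.
have [r [rSb r0 _]] := Sb_lt_b; have [v uv] := point_at_dist u rSb.
have [s [sSb s0 sr]] := Sb_gt0_lt r0.
have /sub : displacement_filter (displacement_ball d u s).
  by apply: sub_gen_smallest; exists u, s; have [] := sSb.
have [g gu] := homogeneous1 u v.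
move=> /seteqP[_ /(_ g I)]; rewrite /displacement_ball /= gu dC uv.
by rewrite leNgt sr.
Qed.

Lemma displacement_sub_preserver : displacement_filter `<=` preserver_filter.
Proof.
move=> N /displacement_filterP[K [x [e [e0 xN]]]].
have [s0 [_ s00 s0b]] := Sb_lt_b.
have [s [sSb s_gt0]] : exists s, [/\ Sb s, 0 < s & s < Num.min s0 (e / 2)].
  by apply: Sb_gt0_lt; rewrite lt_min s00 divr_gt0.
rewrite lt_min => /andP[ss0 se].
have /choice[w xw] l : exists w, d (x l) w = s by exact: point_at_dist.
apply/preserver_filterP; exists K, x, w; split=> [l|g gw].
  by rewrite xw; split=> //; apply: leb_ltb_trans s0b; exact: ltW.
by apply: xN => l; have := d_tri (w l) (g (x l)) (x l); rewrite gw (dC (w l)) xw; lra.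
Qed.

Lemma preserver_sub_stabilizer : preserver_filter `<=` stabilizer_filter.
Proof.
move=> N /preserver_filterP[K [u [v [_ uvN]]]]; apply/stabilizer_filterP.
exists (K + K)%type, (fun t => match t with inl l => u l | inr l => v l end).
by move=> g guv; apply: uvN => l; rewrite (guv (inl l)).
Qed.

Lemma tau_stE : tau_st d = translation_topology stabilizer_filter.
Proof.
apply: generated_group_topologyE; split.
  exact: group_topology_translation stabilizer_group_filter.
exact: nbhs_translation1 stabilizer_group_filter.
Qed.

Lemma tau_mE : tau_m S b d = translation_topology displacement_filter.
Proof.
apply: generated_group_topologyE; split.
  exact: group_topology_translation displacement_group_filter.
exact: nbhs_translation1 displacement_group_filter.
Qed.

Lemma indiscreteE : indiscrete G = translation_topology [set setT].
Proof.
apply/seteqP; split=> A.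
- by case=> -> g //= _; apply/seteqP; split.
- move=> TA; have [[g Ag]|A0] := pselect (exists g, A g); [right|left].
    apply/seteqP; split=> // x _; have /seteqP[_ /(_ (g^-1 * x)%g I)] := TA g Ag.
    by rewrite /= mulVKg.
  by apply/seteqP; split=> // g Ag; apply: A0; exists g.
Qed.

Lemma preserver_sub_all_preserver : preserver_filter `<=` all_preserver_filter.
Proof.
rewrite all_preserver_filterE => N /smallest_filter_family[K [uv [uvP uvN]]].
by apply/smallest_filter_family; exists K, uv; split=> // l; have [] := uvP l.
Qed.

Lemma stabilizer_not_sub_all_preserver :
  ~ stabilizer_filter `<=` all_preserver_filter.
Proof.
have [u _] := urysohn_point; move=> sub; apply: (@stabilizer_not_preserver u).
apply: sub; apply: sub_gen_smallest; exists [set u] => //; exact: finite_set1.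
Qed.

Lemma tau_0p0E : tau_0p0 d = translation_topology preserver_filter.
Proof.
have gp := preserver_group_filter.
have pres_st : all_preserver_filter `<=` stabilizer_filter.
  rewrite all_preserver_filterE => N /smallest_filter_family[K [uv [_ uvN]]].
  apply/stabilizer_filterP.
  exists (K + K)%type, (fun t => match t with inl l => (uv l).1 | inr l => (uv l).2 end).
  move=> g guv; apply: uvN => l; rewrite /distance_preserver /=.
  by rewrite (guv (inl l)).
rewrite /tau_0p0 /generated_group_topology -/all_preserver_filter.
suff -> : \bigcup_(tau in [set tau | group_topology tau /\
    nbhs_of_open tau 1%g `<=` all_preserver_filter]) tau =
    translation_topology preserver_filter.
  by apply: smallest_id; exact: group_topology_translation.
apply/seteqP; split=> [A [tau [gt tau_sub] tauA]|A pA]; last first.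
  exists (translation_topology preserver_filter) => //; split.
    exact: group_topology_translation.
  by rewrite nbhs_translation1//; exact: preserver_sub_all_preserver.
suff /(group_topology_subE gt gp) : nbhs_of_open tau 1%g `<=` preserver_filter by apply.
have gF := group_filter_nbhs gt.
case: (group_filter_classification gF (subset_trans tau_sub pres_st)) => [tau_st|->//|->|->].
- by exfalso; apply: stabilizer_not_sub_all_preserver; rewrite -tau_st.
- exact: displacement_sub_preserver.
- by move=> N ->; apply: filterT; exact: smallest_filter_filter.
Qed.

End Urysohn.

Theorem theoremD (R : realType) (S : set R) (b : \bar R)
    (U : Type) (d : U -> U -> R)
    (S_subgroup : zmod_closed [in S]) (S_dense : dense S)
    (b_bound : b = +oo%E \/ exists r : R, [/\ S r, 0 < r & b = r%:E])
    (U_urysohn : Sb_urysohn S b d) :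
  [set tau : set_system (Isom d) | group_topology tau /\ tau `<=` tau_st d]
    = [set tau_st d; tau_0p0 d; tau_m S b d; indiscrete (Isom d)]
  /\ [/\ tau_0p0 d `<` tau_st d, tau_m S b d `<` tau_0p0 d
       & indiscrete (Isom d) `<` tau_m S b d].
Proof.
pose st : set_system (Isom d) := @stabilizer_filter R U d.
pose p : set_system (Isom d) := @preserver_filter R b U d.
pose m : set_system (Isom d) := @displacement_filter R S b U d.
have gst : group_filter st by exact: stabilizer_group_filter.
have gp : group_filter p by exact: preserver_group_filter U_urysohn.
have gm : group_filter m by exact: displacement_group_filter U_urysohn.
have gT : group_filter [set setT : set (Isom d)] by exact: setT_group_filter.
have p_st : p `<=` st by exact: preserver_sub_stabilizer.
have m_p : m `<=` p by exact: displacement_sub_preserver U_urysohn.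
have T_m : [set setT] `<=` m by move=> N ->; have [? _ _ _ _] := gm; exact: filterT.
have -> : tau_st d = translation_topology st by exact: tau_stE.
have -> : tau_m S b d = translation_topology m by exact: tau_mE U_urysohn.
have -> : tau_0p0 d = translation_topology p by exact: tau_0p0E U_urysohn.
rewrite indiscreteE.
split; last first.
  split; split; rewrite translation_topologyS//.
  - move=> st_p.
    apply: (stabilizer_not_sub_all_preserver S_subgroup S_dense b_bound U_urysohn).
    by apply: subset_trans st_p _; exact: preserver_sub_all_preserver.
  - exact: preserver_not_displacement U_urysohn.
  - exact: displacement_not_trivial U_urysohn.
apply/seteqP; split=> [tau [gt tau_st]|tau].
  have gF := group_filter_nbhs gt.
  have /(group_filter_classification S_subgroup S_dense b_bound U_urysohn gF) :
      nbhs_of_open tau 1%g `<=` st by exact/(group_topology_subE gt gst).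
  move=> F_cases; rewrite (translation_topologyE gt); case: F_cases => ->.
  - by left; left; left.
  - by left; left; right.
  - by left; right.
  - by right.
by case=> [[[]|]|] ->; (split; first exact: group_topology_translation);
  rewrite translation_topologyS//; [exact: subset_trans m_p p_st|
  exact: subset_trans T_m (subset_trans m_p p_st)].
Qed.
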